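(* Let $\kappa>\omega_1$ be a regular cardinal and assume $\mathrm{ADS}^-(\kappa)$. Then there is a pathological dense sub-inner-product-space $X$ of $\ell_2(\kappa)$ such that $X\downarrow\beta$ is non-pathological for every $\beta<\kappa$. Furthermore, for every regular cardinal $\lambda<\kappa$, the set $\{S\in[\kappa]^\lambda: X\downarrow S\text{ is non-pathological}\}$ contains a club subset of $[\kappa]^\lambda$.
   Context: The scalar field $K$ is $\mathbb{R}$ or $\mathbb{C}$. A pre-Hilbert space is an inner product space over $K$ which need not be complete; a sub-inner-product-space is a linear subspace with the restricted inner product. An orthonormal basis is an orthonormal subset whose linear span is dense; a pre-Hilbert space is pathological if it has no orthonormal basis, non-pathological otherwise. $\ell_2(\kappa)=\{\mathbf{u}:\kappa\to K:\sum_x|\mathbf{u}(x)|^2<\infty\}$ with inner product $(\mathbf{u},\mathbf{v})=\sum_x\mathbf{u}(x)\overline{\mathbf{v}(x)}$; $\operatorname{supp}(\mathbf{u})=\{x:\mathbf{u}(x)\neq0\}$; for $S\subseteq\kappa$ (in particular an ordinal $\beta<\kappa$), $X\downarrow S=\{\mathbf{u}\in X:\operatorname{supp}(\mathbf{u})\subseteq S\}$. $[\kappa]^\lambda$ is the set of subsets of $\kappa$ of size $\lambda$; a subset is club if cofinal under $\subseteq$ and closed under unions of $\subseteq$-chains of length $<\lambda$. $E^\omega_\kappa=\{\alpha<\kappa:\operatorname{cf}(\alpha)=\omega\}$. $\mathrm{ADS}^-(\kappa)$ is the assertion that there exist a stationary $S\subseteq E^\omega_\kappa$ and a sequence $\langle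 A_\alpha:\alpha\in S\rangle$ such that $A_\alpha\subseteq\alpha$ has order type $\omega$ for each $\alpha\in S$, and for every $\beta<\kappa$ there is a map $f:S\cap\beta\to\beta$ with $f(\alpha)<\sup(A_\alpha)$ for all $\alpha\in S\cap\beta$ such that the sets $A_\alpha\setminus f(\alpha)$, $\alpha\in S\cap\beta$, are pairwise disjoint. *)

(* Defs.v *)
From mathcomp Require Import all_boot all_order all_algebra.
From mathcomp Require Import complex.
From mathcomp Require Import boolp classical_sets functions cardinality wochoice.
From mathcomp Require Import reals topology normedtype.
From mathcomp.analysis.showcase Require summability.

Set Implicit Arguments.
Unset Strict Implicit.
Unset Printing Implicit Defensive.

Import Order.TTheory GRing.Theory Num.Theory.
Import numFieldNormedType.Exports.

Local Open Scope card_scope.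
Local Open Scope classical_set_scope.
Local Open Scope ring_scope.

Variant scalar_field := RealScalars | ComplexScalars.

Definition base_field (R : realType) (F : scalar_field) : numFieldType :=
  match F with
  | RealScalars => R
  | ComplexScalars => R[i]
  end.

Definition base_conj (R : realType) (F : scalar_field) :
    base_field R F -> base_field R F :=
  match F return base_field R F -> base_field R F with
  | RealScalars => fun z => z
  | ComplexScalars => fun z : R[i] => conjc z
  end.

(* Subspaces of an ambient [V] carrying a form [dot], which need only be an
   inner product on the subspace under consideration; ||w||^2 is dot w w. *)
Section pre_hilbert.
Variables (K : numFieldType) (V : lmodType K) (dot : V -> V -> K).
Implicit Types X Y E : set V.

Definition linear_span E : set V :=
  [set v | exists (n : nat) (a : 'I_n -> K) (e : 'I_n -> V),
     (forall i, E (e i)) /\ v = \sum_(i < n) a i *: e i].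

Definition orthonormal_set E : Prop :=
  (forall e, E e -> dot e e = 1) /\
  (forall e e', E e -> E e' -> e <> e' -> dot e e' = 0).

Definition norm_dense_in X Y : Prop :=
  Y `<=` X /\
  forall u, X u -> forall eps : K, 0 < eps ->
    exists2 v, Y v & dot (u - v) (u - v) < eps ^+ 2.

Definition orthonormal_basis X E : Prop :=
  [/\ E `<=` X, orthonormal_set E & norm_dense_in X (linear_span E)].

Definition nonpathological X : Prop := exists E, orthonormal_basis X E.

Definition pathological X : Prop := ~ nonpathological X.

End pre_hilbert.

(* The sums over [I] are unordered: limits of the finite partial sums along
   the directed family of finite subsets of [I]. *)
Section ell2.
Variables (R : realType) (F : scalar_field) (I : choiceType).
Local Notation K := (base_field R F).
Implicit Types (u v : I -> K^o) (X : set (I -> K^o)) (S : set I).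

Definition ell2 : set (I -> K^o) :=
  [set u | cvg (summability.partial_sum (fun x => `|u x| ^+ 2 : K^o)
                  @ summability.totally)].

Definition ell2_dot u v : K :=
  summability.sum (fun x => (u x * base_conj (v x) : K^o)).

Definition supp u : set I := [set x | u x != 0].

Definition restrict_supp X S : set (I -> K^o) := 
  X `&` [set u | supp u `<=` S].

Definition sub_inner_product_space X : Prop :=
  X `<=` ell2 /\ submod_closed [in X].

End ell2.

(* An ordinal is a well-ordered type [kappa]; the ordinals below it are its
   elements, and the element [a], as a set of ordinals, is [below a]. *)
Section ordinals.
Context {d : Order.disp_t} {kappa : orderType d}.
Implicit Types (a b : kappa) (A C D S : set kappa).

Definition below a : set kappa := [set x | (x < a)%O].

Definition cofinal_in D A : Prop :=
  A `<=` D /\ forall x, D x -> exists2 y, A y & (x <= y)%O.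

(* cf(D) = |M| *)
Definition has_cofinality D (T : Type) (M : set T) : Prop :=
  (exists2 A, cofinal_in D A & A #= M) /\
  (forall A, cofinal_in D A -> M #<= A).

(* For D an initial segment: D is an infinite initial ordinal with
   cf(D) = D. *)
Definition regular_cardinal D : Prop :=
  [/\ infinite_set D,
      forall a, D a -> ~ (D #<= below a)
    & has_cofinality D D].

Definition is_omega1 a : Prop :=
  ~ countable (below a) /\ forall b, (b < a)%O -> countable (below b).

Definition E_omega : set kappa :=
  [set a | has_cofinality (below a) [set: nat]].

Definition order_type_omega A : Prop :=
  exists2 g : nat -> kappa,
    {homo g : m n / (m < n)%N >-> (m < n)%O} & range g = A.

(* The nonzero [a] satisfying the second premise of closedness are the limit
   ordinals in which [C] is unbounded. *)
Definition club C : Prop :=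
  cofinal_in setT C /\
  forall a, below a !=set0 ->
    (forall b, (b < a)%O -> exists2 c, C c & (b < c < a)%O) -> C a.

Definition stationary S : Prop := forall C, club C -> S `&` C !=set0.

Definition subsets_of_size (l : kappa) : set (set kappa) :=
  [set S | S #= below l].

(* Chains are increasing sequences of nonzero length delta < l. *)
Definition club_of_subsets (l : kappa) (C : set (set kappa)) : Prop :=
  [/\ C `<=` subsets_of_size l,
      forall S, subsets_of_size l S -> exists2 S', C S' & S `<=` S'
    & forall (delta : kappa) (G : kappa -> set kappa),
        (delta < l)%O -> below delta !=set0 ->
        (forall i, below delta i -> C (G i)) ->
        (forall i j, (i <= j)%O -> below delta j -> G i `<=` G j) ->
        C (\bigcup_(i in below delta) G i)].

End ordinals.

(* The default value in [supremum] is irrelevant: the supremum exists as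
   A a is nonempty and bounded by a. *)
Definition ADS_minus (d : Order.disp_t) (kappa : orderType d) : Prop :=
  exists (S : set kappa) (A : kappa -> set kappa),
    [/\ stationary S,
        S `<=` E_omega,
        forall a, S a -> A a `<=` below a /\ order_type_omega (A a)
      & forall b : kappa, exists f : kappa -> kappa,
          (forall a, (S `&` below b) a ->
             (f a < b)%O /\ (f a < supremum a (A a))%O) /\
          trivIset (S `&` below b) (fun a => A a `\` below (f a))].

(* Main.v *)
Require Import Defs.
From mathcomp Require Import all_boot all_order all_algebra finmap.
From mathcomp Require Import complex ring.
From mathcomp Require Import boolp classical_sets functions cardinality wochoice.
From mathcomp Require Import reals topology normedtype.
From mathcomp.analysis.showcase Require Import summability.

(* The ladders, pushed up to successor ordinals so that they avoid S, give the
   vectors u_a = e_a + sum_k 2^-k e_(g a k) for a in S; X is spanned by these and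
   by the e_x with x outside S.

   If T is bounded and closed under ladders, ADS^- makes the tails of the ladders
   attached to points of T disjoint; X restricted to T is then spanned by mutually
   orthogonal blocks of countable dimension, one for each a in S and T, in which
   Gram-Schmidt yields an orthonormal basis.

   If B were an orthonormal basis of X, then by Bessel's inequality only countably
   many members of B are nonzero at a given point, so there is a club of a such
   that no member of B with a point of its support below a is nonzero at a. For a
   in S in this club, some b in B has b(a) <> 0, hence b vanishes below a; but the
   u_a-coefficient of b is b(a), and since ladders are almost disjoint,
   b(g a k) = 2^-k b(a) <> 0 for large k. *)

Set Implicit Arguments.
Unset Strict Implicit.
Unset Printing Implicit Defensive.

Import Order.TTheory GRing.Theory Num.Theory.
Import numFieldNormedType.Exports.

Local Open Scope card_scope.
Local Open Scope classical_set_scope.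
Local Open Scope ring_scope.

(* The space has to be dense in l2 without containing a vector that isolates a point a of S from
   everything below it: e_a lies in the closure of X but not in X, and each vector of X that is
   nonzero at a has a further support point below a. Since the rungs avoid S, evaluation at a reads
   off the coefficient of u_a, and every e_(g a k) belongs to X. Hence finitely many rungs can be
   erased from u_a without leaving X. This freedom yields density, and it also allows the initial
   segments on which ladders may overlap to be cut away. The cut-off N depends on the bound b; ADS^-
   offers none that serves all of kappa at once, which is why good bounded pieces can coexist with a
   pathological whole. Initial segments and sets of size lambda are handled alike: both are bounded,
   the former are closed under ladders because rungs lie below their points, and the latter can be
   closed under ladders without growing in size. *)
#[local] Existing Instance totally_filter.

(** * Cardinals and ordinals *)

Section cardinals.

Lemma card_le_fun T U (A : set T) (B : set U) (u0 : U) : A #<= B ->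
  exists f : T -> U, (forall x, A x -> B (f x)) /\
    (forall x y, A x -> A y -> f x = f y -> x = y).
Proof.
move=> /card_leP[f].
pose g x := if pselect (A x) is left Ax then val (f (exist _ x (mem_set Ax))) else u0.
exists g; split=> [x Ax|x y Ax Ay].
  by rewrite /g; case: pselect => // Ax'; apply: set_valP.
rewrite /g; case: pselect => // Ax'; case: pselect => // Ay' /val_inj/inj fxy.
have := fxy; rewrite !in_setE => /(_ I I) /(congr1 val) //.
Qed.

Lemma fun_card_le T U (A : set T) (B : set U) (f : T -> U) :
  (forall x, A x -> B (f x)) -> (forall x y, A x -> A y -> f x = f y -> x = y) -> A #<= B.
Proof.
move=> fAB finj.
have /injfunPex[h] : exists2 f : T -> U, set_fun A B f & set_inj A f.
  by exists f => // x y; rewrite !inE; apply: finj.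
exact: inj_card_le h.
Qed.

Lemma min_wf T (lt : T -> T -> Prop) :
  (forall A : set T, A !=set0 -> exists p, A p /\ forall q, A q -> ~ lt q p) ->
  well_founded lt.
Proof.
move=> Hmin p; apply: contrapT => nAcc.
have [q [nq Hq]] := Hmin [set q | ~ Acc lt q] (ex_intro _ p nAcc).
by apply: nq; constructor => r rq; apply: contrapT => nr; apply: Hq nr rq.
Qed.

Lemma wf_card_le T U (lt : T -> T -> Prop) (D : set T) (B : set U) (u0 : U) :
  well_founded lt ->
  (forall p q, D p -> D q -> p <> q -> lt p q \/ lt q p) ->
  (forall p, D p -> ~ (B #<= [set q | D q /\ lt q p])) -> D #<= B.
Proof.
move=> wf tot small.
pose Fh p (rec : forall q, lt q p -> U) : U :=
  if pselect (exists u, B u /\ forall q (qp : lt q p), D q -> rec q qp <> u)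
  is left e then projT1 (cid e) else u0.
pose h := Fix wf (fun _ => U) Fh.
have hE p : h p = Fh p (fun q _ => h q).
  apply: Fix_eq => x f g fg; congr (Fh x _).
  by apply: functional_extensionality_dep => y; apply/funext => yx.
have hP p : D p -> B (h p) /\ forall q, lt q p -> D q -> h q <> h p.
  move=> Dp; rewrite hE /Fh; case: pselect => [e|ne].
    by case: (projT2 (cid e)) => Bu Hu; split => // q qp; apply: Hu.
  exfalso; apply: (small p Dp).
  apply: (@card_le_trans _ _ _ (h @` [set q | D q /\ lt q p])); last exact: card_image_le.
  apply: subset_card_le => u Bu; apply: contrapT => nu; apply: ne.
  by exists u; split=> // q qp Dq hq; apply: nu; exists q.
apply: (@fun_card_le _ _ _ _ h) => [x /hP[]//|x y Dx Dy hxy].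
apply: contrapT => nxy; case: (tot x y Dx Dy nxy) => l.
  by case: (hP y Dy) => _ /(_ x l Dx).
by case: (hP x Dx) => _ /(_ y l Dy); rewrite hxy.
Qed.

Lemma card_le_prod T U T' U' (A : set T) (B : set U) (A' : set T') (B' : set U') :
  A #<= A' -> B #<= B' -> A `*` B #<= A' `*` B'.
Proof.
move=> AA' BB'.
case: (pselect (exists p, A' p)) => [[a0 _]|nA]; last first.
  suff -> : A `*` B = set0 by exact: card_ge0.
  have : A #<= @set0 T'.
    by rewrite -(_ : A' = set0)//; apply/seteqP; split=> // x Ax; case: nA; exists x.
  by rewrite card_le0 => /eqP ->; rewrite set0X.
case: (pselect (exists p, B' p)) => [[b0 _]|nB]; last first.
  suff -> : A `*` B = set0 by exact: card_ge0.
  have : B #<= @set0 U'.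
    by rewrite -(_ : B' = set0)//; apply/seteqP; split=> // x Ax; case: nB; exists x.
  by rewrite card_le0 => /eqP ->; rewrite setX0.
have [f [f1 f2]] := card_le_fun a0 AA'.
have [g [g1 g2]] := card_le_fun b0 BB'.
apply: (@fun_card_le _ _ _ _ (fun p => (f p.1, g p.2))).
  by move=> [x y] [/= Ax By]; split; [apply: f1|apply: g1].
move=> [x y] [x' y'] [/= Ax By] [/= Ax' By'] [/(f2 _ _ Ax Ax') -> /(g2 _ _ By By') ->//].
Qed.

(** A point is coded by a chosen index of a set containing it, paired with its image under the
    injection chosen for that index. *)
Lemma bigcup_card_le T U (I : Type) (J : set I) (G : I -> set T) (D : set U) :
  D `*` D #<= D -> J #<= D -> (forall i, J i -> G i #<= D) ->
  \bigcup_(i in J) G i #<= D.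
Proof.
move=> DD JD GD.
case: (pselect (exists p, D p)) => [[u0 _]|nD]; last first.
  suff -> : \bigcup_(i in J) G i = set0 by exact: card_ge0.
  have : J #<= @set0 U.
    by rewrite -(_ : D = set0)//; apply/seteqP; split=> // x Ax; case: nD; exists x.
  by rewrite card_le0 => /eqP ->; rewrite bigcup_set0.
have /choice[f Hf] : forall i, exists f : T -> U, J i -> (forall x, G i x -> D (f x)) /\
    (forall x y, G i x -> G i y -> f x = f y -> x = y).
  move=> i; case: (pselect (J i)) => [Ji|nJ]; last by exists (fun=> u0).
  by have [f hf] := card_le_fun u0 (GD i Ji); exists f.
have [->|/set0P[x0 [i0 _ _]]] := eqVneq (\bigcup_(i in J) G i) set0; first exact: card_ge0.
have /choice[c Hc] : forall x, exists i, (\bigcup_(i in J) G i) x -> J i /\ G i x.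
  by move=> x; case: (pselect ((\bigcup_(i in J) G i) x)) => [[i Ji Gi]|?]; [exists i|exists i0].
apply: card_le_trans DD; apply: (@card_le_trans _ _ _ (J `*` D)); last first.
  by apply: card_le_prod.
apply: (@fun_card_le _ _ _ _ (fun x => (c x, f (c x) x))).
  by move=> x /Hc[Jc Gc]; split => //=; apply: (Hf _ Jc).1.
move=> x y /Hc[Jx Gx] /Hc[Jy Gy] [cxy]; rewrite -cxy; apply: (Hf _ Jx).2 => //.
by rewrite cxy.
Qed.

Lemma infinite_card_leU1 T (D : set T) (x : T) : infinite_set D ->
  D `*` D #<= D -> D `|` [set x] #<= D.
Proof.
move=> Di DD.
have -> : D `|` [set x] = \bigcup_(b in [set: bool]) (if b then D else [set x]).
  apply/seteqP; split=> y; first by case=> h; [exists true|exists false].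
  by case=> -[] _ h; [left|right].
have natD : [set: nat] #<= D by apply/infiniteP.
apply: bigcup_card_le => //.
  by apply: card_le_trans natD; apply: countableP.
move=> [] _ //; apply: card_le_trans natD; exact: countable1.
Qed.
End cardinals.

(** * Squares of ordinals, bounded sets, successors and ladders *)

Section ordinals.
Context {d : Order.disp_t} {kappa : orderType d}.
Hypothesis kappa_wo : well_order (<=%O : rel kappa).
Implicit Types (a b x y : kappa) (A : set kappa).

Lemma wo_min A : A !=set0 -> exists m, A m /\ forall x, A x -> (m <= x)%O.
Proof.
move=> [x Ax]; have [|m [[mA mlb] _]] := @kappa_wo (mem A).
  by exists x; apply: mem_set.
exists m; split; first by apply/set_mem.
by move=> y Ay; apply: mlb; apply: mem_set.
Qed.

Lemma wf_lt : well_founded (fun x y : kappa => (x < y)%O).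
Proof.
apply: min_wf => A /wo_min[m [Am mlb]]; exists m; split=> // y Ay ym.
by have := le_lt_trans (mlb y Ay) ym; rewrite ltxx.
Qed.

(* Goedel's well-ordering of pairs: an initial segment lies in the square of a
   proper initial segment of kappa. *)
Definition pair_lt (p q : kappa * kappa) : Prop :=
  (Order.max p.1 p.2 < Order.max q.1 q.2)%O \/
  Order.max p.1 p.2 = Order.max q.1 q.2 /\
  ((p.1 < q.1)%O \/ p.1 = q.1 /\ (p.2 < q.2)%O).

Lemma wf_pair_lt : well_founded pair_lt.
Proof.
apply: min_wf => A [p0 Ap0].
have [m [[p1 Ap1 p1m] mlb]] : exists m, [set Order.max p.1 p.2 | p in A] m /\
    forall x, [set Order.max p.1 p.2 | p in A] x -> (m <= x)%O.
  by apply: wo_min; exists (Order.max p0.1 p0.2); exists p0.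
pose A1 := A `&` [set p | Order.max p.1 p.2 = m].
have [n [[p2 Ap2 p2n] nlb]] : exists n, [set p.1 | p in A1] n /\
    forall x, [set p.1 | p in A1] x -> (n <= x)%O.
  by apply: wo_min; exists p1.1; exists p1.
pose A2 := A1 `&` [set p | p.1 = n].
have [k [[p3 [[Ap3 p3m] p3n] p3k] klb]] : exists k, [set p.2 | p in A2] k /\
    forall x, [set p.2 | p in A2] x -> (k <= x)%O.
  by apply: wo_min; exists p2.2; exists p2.
exists p3; split=> // q Aq [|[qm [|[qn]]]].
- have : (m <= Order.max q.1 q.2)%O by apply: mlb; exists q.
  by rewrite -p3m => /le_lt_trans h /h; rewrite ltxx.
- have : (n <= q.1)%O by apply: nlb; exists q => //; split=> //; rewrite /= qm.
  by rewrite -p3n => /le_lt_trans h /h; rewrite ltxx.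
- have : (k <= q.2)%O.
    by apply: klb; exists q => //; split; [split => //; rewrite /= qm|rewrite /= qn].
  by rewrite -p3k => /le_lt_trans h /h; rewrite ltxx.
Qed.

Lemma pair_lt_total p q : p <> q -> pair_lt p q \/ pair_lt q p.
Proof.
case: p q => [x y] [x' y'] npq; rewrite /pair_lt /=.
case: (ltgtP (Order.max x y) (Order.max x' y')) => [|| ->]; [by left; left|by right; left|].
case: (ltgtP x x') => [||xx'];
  [by left; right; split=> //; left|by right; right; split=> //; left|].
case: (ltgtP y y') => [||yy'];
  [by left; right; split=> //; right|by right; right; split=> //; right|].
by case: npq; rewrite xx' yy'.
Qed.

(** Hessenberg's theorem by induction on [a]. If [a] has the size of a smaller ordinal, the claim
    transfers. Otherwise [a] is an initial ordinal, and the pairs preceding p lie in the square of m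
    + 1, where m < a is the larger coordinate; by induction that square has the size of m or is
    finite, hence is smaller than [a], and [wf_card_le] applies. *)
Lemma below_square a : infinite_set (below a) -> below a `*` below a #<= below a.
Proof.
elim/(well_founded_ind wf_lt): a => a IH infa.
case: (pselect (exists2 b, (b < a)%O & below a #<= below b)) => [[b ba ab]|nb].
  have infb : infinite_set (below b).
    by move=> fb; apply: infa; exact: card_le_finite ab fb.
  apply: card_le_trans (card_le_prod ab ab) _.
  apply: card_le_trans (IH b ba infb) _.
  by apply: subset_card_le => x; rewrite /below /= => /lt_trans; apply.
apply: (@wf_card_le _ _ pair_lt _ _ a wf_pair_lt).
  by move=> p q _ _; apply: pair_lt_total.
move=> p [p1 p2] hp; pose m := Order.max p.1 p.2.
have ma : (m < a)%O by rewrite gt_max; apply/andP; split.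
have hm : below a #<= (below m `|` [set m]) `*` (below m `|` [set m]).
  apply: card_le_trans hp _; apply: subset_card_le => q [_ qp].
  have : (Order.max q.1 q.2 <= m)%O.
    by case: qp => [/ltW//|[-> _]].
  have le x : (x <= m)%O -> (below m `|` [set m]) x.
    by rewrite le_eqVlt => /orP[/eqP|]; [right|left].
  by rewrite ge_max => /andP[l1 l2]; split; apply: le.
case: (pselect (finite_set (below m))) => [fm|im].
  apply: infa; apply: card_le_finite hm _; apply: finite_setX;
    by rewrite finite_setU; split => //; exact: finite_set1.
apply: nb; exists m => //; apply: card_le_trans hm _.
have mm := infinite_card_leU1 m im (IH m ma im).
exact: card_le_trans (card_le_prod mm mm) (IH m ma im).
Qed.

Hypothesis kappa_regular : regular_cardinal [set: kappa].
Hypothesis omega1_lt_kappa : exists a : kappa, is_omega1 a.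

Lemma small_bounded A : ~ ([set: kappa] #<= A) -> exists b, A `<=` below b.
Proof.
case: kappa_regular => _ _ [_ cofA] nA; apply: contrapT => nb; apply: nA; apply: cofA.
split=> // x _; apply: contrapT => nx; apply: nb; exists x => y Ay; rewrite /below /=.
by rewrite ltNge; apply/negP => xy; apply: nx; exists y.
Qed.

(** This is where [omega1_lt_kappa] enters: a countable set cannot have the size of kappa, since
    kappa contains the uncountable segment below omega_1. *)
Lemma countable_bounded A : countable A -> exists b, A `<=` below b.
Proof.
move=> cA; apply: small_bounded => tA; case: omega1_lt_kappa => o [nco _].
by apply: nco; apply: sub_countable cA; apply: card_le_trans tA; apply: subset_card_le.
Qed.

Lemma exists_succ x : exists s, (x < s)%O /\ forall y, (x < y)%O -> (s <= y)%O.
Proof.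
have [b xb] := countable_bounded (countable1 x).
by apply: (@wo_min [set y | (x < y)%O]); exists b; apply: xb.
Qed.

Definition succ x := projT1 (cid (exists_succ x)).

Lemma lt_succ x : (x < succ x)%O.
Proof. by case: (projT2 (cid (exists_succ x))). Qed.

Lemma succ_le x y : (x < y)%O -> (succ x <= y)%O.
Proof. by case: (projT2 (cid (exists_succ x))) => _; apply. Qed.

Lemma ltS_le x y : (x < succ y)%O = (x <= y)%O.
Proof.
apply/idP/idP => [|/le_lt_trans]; last by apply; apply: lt_succ.
by rewrite !leNgt; apply: contraL => /succ_le; rewrite leNgt.
Qed.

Lemma succ_inj : injective succ.
Proof.
by move=> x y xy; apply/eqP; rewrite eq_le -!ltS_le -xy lt_succ xy lt_succ.
Qed.

(** The single point [x] is cofinal below its successor, so the cofinality there is one. *)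
Lemma succ_not_E_omega x : ~ E_omega (succ x).
Proof.
move=> [_ /(_ [set x])] h; have : [set: nat] #<= [set x].
  apply: h; split=> [_ ->|y]; first exact: lt_succ.
  by rewrite /below /= ltS_le => yx; exists x.
by move/infiniteP; apply; exact: finite_set1.
Qed.

(** For unboundedness, [z x] exceeds x and bounds h on all y up to x; it exists by regularity,
    because these y are fewer than kappa. The supremum of the iterates of [z] from [x0] is a closure
    point: anything below it is already below some iterate, and the next iterate bounds its
    image. *)
Lemma closure_points_club (h : kappa -> kappa) :
  club [set a | forall x, (x < a)%O -> (h x <= a)%O].
Proof.
split; last first.
  move=> a _ lim x /lim[c Cc /andP[xc ca]].
  exact: le_trans (Cc x xc) (ltW ca).
split=> // x0 _.
have /choice[z Hz] x : exists z, (x < z)%O /\ forall y, (y <= x)%O -> (h y <= z)%O.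
  have [b hb] : exists b, h @` below (succ x) `<=` below b.
    apply: small_bounded => /card_le_trans /(_ (card_image_le _ _)).
    by case: kappa_regular => _ /(_ (succ x) I).
  exists (Order.max (succ x) b); split; first by rewrite lt_max lt_succ.
  move=> y yx; rewrite le_max (ltW (hb (h y) _)) ?orbT//.
  by exists y => //; rewrite /below /= ltS_le.
pose s n := iter n z x0.
have [a [ua la]] : exists a, (forall n, (s n <= a)%O) /\
    forall b, (forall n, (s n <= b)%O) -> (a <= b)%O.
  have [b hb] : exists b, range s `<=` below b.
    by apply: countable_bounded; apply: card_le_trans (card_image_le _ _) _; apply: card_lexx.
  apply: (@wo_min [set a | forall n, (s n <= a)%O]); exists b => n.
  by apply: ltW; apply: hb; exists n.
exists a; last exact: (ua 0%N).
move=> x xa.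
have [n xn] : exists n, (x < s n)%O.
  apply: contrapT => nn; have : (a <= x)%O.
    by apply: la => n; rewrite leNgt; apply/negP => sx; apply: nn; exists n.
  by rewrite leNgt xa.
apply: le_trans (ua n.+1); exact: (Hz (s n)).2 (ltW xn).
Qed.

(** ADS^- recast for enumerated ladders: the ordinal cut-off [f a] becomes an index [N a] from which
    all rungs lie at or above [f a]. Disjointness of the tails survives the shift because [succ] is
    injective. *)
Lemma almost_disjoint_ladders : ADS_minus kappa ->
  exists (S : set kappa) (g : kappa -> nat -> kappa),
    [/\ stationary S,
        forall a, S a -> injective (g a),
        forall a n, S a -> (g a n < a)%O,
        forall a n, ~ S (g a n)
      & forall b, exists N : kappa -> nat, forall a a' j k,
          S a -> S a' -> (a < b)%O -> (a' < b)%O ->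
          (N a <= j)%N -> (N a' <= k)%N -> g a j = g a' k -> a = a'].
Proof.
move=> [S [A [statS SE HA ads]]].
have /choice[g0 Hg0] a : exists g : nat -> kappa, S a ->
    {homo g : m n / (m < n)%N >-> (m < n)%O} /\ range g = A a.
  case: (pselect (S a)) => [Sa|nSa]; last by exists (fun=> a).
  by have [_ [g h1 h2]] := HA a Sa; exists g.
exists S, (fun a n => succ (g0 a n)); split => //.
- move=> a /Hg0[gm _] m n /succ_inj gmn.
  by case: (ltngtP m n) => // /gm; rewrite gmn ltxx.
- move=> a n Sa; have [gm gA] := Hg0 a Sa.
  (* The successor of a rung is at most the next rung of the original ladder, so shifting does not
     reach [a]. *)
  have /succ_le h : (g0 a n < g0 a n.+1)%O by apply: gm.
  apply: le_lt_trans h _; have [sub _] := HA a Sa; apply: sub.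
  by rewrite -gA; exists n.+1.
- by move=> a n /SE; apply: succ_not_E_omega.
move=> b; have [f [f1 f2]] := ads b.
have /choice[N HN] a : exists n, S a -> (a < b)%O ->
    forall j, (n <= j)%N -> (f a <= g0 a j)%O.
  case: (pselect (S a)) => [Sa|nSa]; last by exists 0%N.
  case: (boolP (a < b)%O) => [ab|nab]; last by exists 0%N.
  have [gm gA] := Hg0 a Sa.
  have [_ fsup] := f1 a (conj Sa ab).
  suff [n fn] : exists n, (f a <= g0 a n)%O.
    exists n => _ _ j; rewrite leq_eqVlt => /orP[/eqP <-//|/gm/ltW].
    exact: le_trans.
  apply: contrapT => nn.
  have ub : ubound (A a) (f a).
    move=> x; rewrite -gA => -[n _ <-]; rewrite leNgt; apply/negP => l.
    by apply: nn; exists n; apply: ltW.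
  (* The ladder is nonempty, so the default of [supremum] is discarded; by well-ordering a least
     upper bound exists, so [xget] returns one, and the upper bound [f a] cannot lie strictly below
     it. *)
  move: fsup; rewrite /supremum ifF; last first.
    by apply/negbTE/set0P; exists (g0 a 0%N); rewrite -gA; exists 0%N.
  have [m [mub mlb]] : exists m, ubound (A a) m /\ forall x, ubound (A a) x -> (m <= x)%O.
    by apply: wo_min; exists (f a).
  have [_ lb] := @xgetPex _ a (supremums (A a)) (ex_intro _ m (conj mub mlb)).
  by rewrite ltNge (lb _ ub).
exists N => a a' j k Sa Sa' ab a'b Nj Nk /succ_inj gg.
have inA c i : S c -> (c < b)%O -> (N c <= i)%N -> (A c `\` below (f c)) (g0 c i).
  move=> Sc cb Ni; split; first by have [_ <-] := Hg0 c Sc; exists i.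
  by rewrite /below /= => l; have := HN c Sc cb i Ni; rewrite leNgt l.
apply: (f2 a a' (conj Sa ab) (conj Sa' a'b)).
by exists (g0 a j); split; [apply: inA|rewrite gg; apply: inA].
Qed.

(** * Sets closed under ladders *)

Section closed_sets.
Variables (S : set kappa) (g : kappa -> nat -> kappa).
Hypothesis gS : forall a n, ~ S (g a n).

Definition ladder_closed (T : set kappa) := forall a n, S a -> T a -> T (g a n).

(** One round of adding rungs closes a set, because a rung is never in [S] and so has no ladder of
    its own to add. The size stays l: each ladder is countable and l is infinite with l * l = l. In
    the union of a chain, the rungs of a point lie in any member that contains the point. *)
Lemma ladder_closed_club (l : kappa) : regular_cardinal (below l) ->
  club_of_subsets l [set T | subsets_of_size l T /\ ladder_closed T].
Proof.
move=> [infl _ _]; have sq := below_square infl.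
have natl : [set: nat] #<= below l by apply/infiniteP.
split; first by move=> T [].
- move=> T sT; pose T' := \bigcup_(a in T) ([set a] `|` [set x | S a /\ exists n, x = g a n]).
  have TT' : T `<=` T' by move=> a Ta; exists a => //; left.
  exists T' => //; split.
    rewrite /subsets_of_size /= card_eq_le; apply/andP; split.
      apply: bigcup_card_le => //.
        by move: sT; rewrite /subsets_of_size /= card_eq_le => /andP[].
      move=> a Ta; apply: card_le_trans natl; rewrite -/(countable _).
      rewrite (_ : _ `|` _ = \bigcup_(b in [set: bool])
          (if b then [set a] else [set x | S a /\ exists n, x = g a n])).
        apply: bigcup_countable => // -[] _; first exact: countable1.
        have c : countable (range (g a)).
          by apply: card_le_trans (card_image_le _ _) _; apply: card_lexx.
        by apply: sub_countable c; apply: subset_card_le => x [_ [n ->]]; exists n.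
      apply/seteqP; split=> y; first by case=> h; [exists true|exists false].
      by case=> -[] _ h; [left|right].
    apply: card_le_trans (subset_card_le TT').
    by move: sT; rewrite /subsets_of_size /= card_eq_le => /andP[].
  move=> a n Sa [b Tb [/= ab|[Sb [k ak]]]]; last by case: (@gS b k); rewrite -ak.
  by exists b => //; right; rewrite -ab; split => //; exists n.
- move=> dl G dll [i0 hi0] GC _; split.
    rewrite /subsets_of_size /= card_eq_le; apply/andP; split.
      apply: bigcup_card_le => // [|i /GC[]].
        by apply: subset_card_le => x; rewrite /below /= => /lt_trans; apply.
      by rewrite /subsets_of_size /= card_eq_le => /andP[].
    have [] := GC _ hi0; rewrite /subsets_of_size /= card_eq_le => /andP[_ h] _.
    by apply: card_le_trans h _; apply: subset_card_le => x Gx; exists i0.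
  by move=> a n Sa [i hi Ga]; exists i => //; apply: (GC _ hi).2.
Qed.
End closed_sets.

Lemma small_size_bounded (l : kappa) T : subsets_of_size l T -> exists b, T `<=` below b.
Proof.
move=> sT; apply: small_bounded => kT; case: kappa_regular => _ /(_ l I) h _; apply: h.
by apply: card_le_trans kT _; move: sT; rewrite /subsets_of_size /= card_eq_le => /andP[].
Qed.
End ordinals.

(** * Unordered sums and the inner product of l2 *)

Section scalars.
Variable (R : realType) (F : scalar_field).
Local Notation K := (base_field R F).
Local Notation cj := (@base_conj R F).

Lemma base_conjD (a b : K) : cj (a + b) = cj a + cj b.
Proof. by case: F a b => //= a b; rewrite raddfD. Qed.

Lemma base_conjM (a b : K) : cj (a * b) = cj a * cj b.
Proof. by case: F a b => //= a b; rewrite rmorphM. Qed.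

Lemma base_conjK (a : K) : cj (cj a) = a.
Proof. by case: F a => //= a; rewrite conjcK. Qed.

(** In the order of [R[i]] a nonnegative element has zero imaginary part. The lemma also serves for
    the conjugates of 0 and 1. *)
Lemma base_conj_ge0 (a : K) : 0 <= a -> cj a = a.
Proof.
case: F a => //= -[x y]; rewrite lecE /= => /andP[/eqP -> _].
by rewrite oppr0.
Qed.

Lemma base_conjN (a : K) : cj (- a) = - cj a.
Proof. by apply/eqP; rewrite -addr_eq0 -base_conjD addNr base_conj_ge0. Qed.

Lemma base_conj_norm (a : K) : `|cj a| = `|a|.
Proof. by case: F a => //= -[x y]; rewrite normc_def /= sqrrN. Qed.

Lemma mul_base_conj (a : K) : a * cj a = `|a| ^+ 2.
Proof. 
case: F a => /= a; first by rewrite -normrX ger0_norm ?sqr_ge0.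
by rewrite sqr_normc.
Qed.

Lemma base_sqrt (a : K) : 0 <= a -> exists2 b : K, 0 <= b & b ^+ 2 = a.
Proof.
case: F a => /= a a0; first by exists (Num.sqrt a); rewrite ?sqrtr_ge0 ?sqr_sqrtr.
exists (sqrtC a); rewrite ?sqrtC_ge0 ?sqrtCK//.
Qed.

Lemma base_archi (a : K) : 0 < a -> exists n : nat, 1 <= n%:R * a.
Proof.
have H : forall a : R, 0 < a -> exists n : nat, 1 <= n%:R * a.
  move=> x x0; exists (Num.bound x^-1).
  rewrite -ler_pdivrMr// mul1r; apply: ltW.
  by apply: archi_boundP; rewrite invr_ge0 ltW.
case: F a => //= -[x y]; rewrite ltcE /= => /andP[/eqP -> /H[n Hn]].
exists n; rewrite -[n%:R](rmorph_nat (@real_complex R)) lecE /=.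
by rewrite !mulr0 mul0r subr0 addr0 eqxx.
Qed.

End scalars.

(** * Absolutely summable families *)

Section sums.
Variable (I : choiceType).

Lemma partial_sumE (M : zmodType) (f : I -> M) (J : {fset I}) :
  partial_sum f J = \sum_(i <- J) f i.
Proof. by rewrite /partial_sum big_seq_fsetE. Qed.

Lemma fset_sum_subset (M : zmodType) (f : I -> M) (J J' : {fset I}) :
  (J `<=` J')%fset -> (forall i, i \in J' -> i \notin J -> f i = 0) ->
  \sum_(i <- J) f i = \sum_(i <- J') f i.
Proof.
move=> sJ f0; rewrite [RHS](big_fsetID _ [in J]) /=.
rewrite [X in _ = _ + X]big_seq_cond [X in _ = _ + X]big1 ?addr0; last first.
  by move=> i; rewrite !inE /= => /andP[/andP[iJ' iJ] _]; apply: f0.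
apply: perm_big; apply: uniq_perm; rewrite ?fset_uniq// => i.
rewrite !inE /=; case: (boolP (i \in J)) => [iJ|]; last by rewrite andbF.
by rewrite (fsubsetP sJ).
Qed.

Lemma ler_fset_sum (K : numDomainType) (f : I -> K) (J J' : {fset I}) :
  (forall i, 0 <= f i) -> (J `<=` J')%fset ->
  \sum_(i <- J) f i <= \sum_(i <- J') f i.
Proof.
move=> f0 sJ; rewrite [leRHS](big_fsetID _ [in J]) /=.
rewrite [X in _ <= X + _](_ : _ = \sum_(i <- J) f i) ?lerDl ?sumr_ge0//.
apply: perm_big; apply: uniq_perm; rewrite ?fset_uniq// => i.
rewrite !inE /=; case: (boolP (i \in J)) => [iJ|]; last by rewrite andbF.
by rewrite (fsubsetP sJ).
Qed.

(** Absolute summability stated without limits: it passes to dominated families at once, and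
    [bounded_cvg] turns it into convergence over either field. *)
Definition bounded_sums (K : numDomainType) (f : I -> K) :=
  exists M, forall J : {fset I}, \sum_(i <- J) `|f i| <= M.

Lemma near_totally (J0 : {fset I}) (P : {fset I} -> Prop) :
  (forall J, (J0 `<=` J)%fset -> P J) -> \forall J \near totally, P J.
Proof. by move=> H; exists J0. Qed.

Lemma totally_nearP (P : {fset I} -> Prop) :
  (\forall J \near totally, P J) ->
  exists J0 : {fset I}, forall J, (J0 `<=` J)%fset -> P J.
Proof. by case=> J0 _ H; exists J0. Qed.

Lemma nneg_bounded_cvg (R : realType) (f : I -> R^o) :
  (forall i, 0 <= f i) -> bounded_sums f -> cvg (partial_sum f @ totally).
Proof.
move=> f0 [M HM].
pose E := [set \sum_(i <- J) f i | J in [set: {fset I}]].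
have supE : has_sup E.
  split; first by exists (\sum_(i <- fset0) f i); exists fset0.
  exists M => _ [J _ <-]; apply: le_trans (HM J).
  by apply: ler_sum => i _; apply: ler_norm.
apply: (@cvgP _ _ (sup E : R^o)); apply/cvgrPdist_lt => /= e e0.
have [_ [J0 _ <-] HJ0] := sup_adherent e0 supE.
apply: (near_totally (J0 := J0)) => J sJ; rewrite partial_sumE.
have le1 : \sum_(i <- J) f i <= sup E.
  by apply: ub_le_sup; [case: supE | exists J].
rewrite ger0_norm ?subr_ge0//.
by rewrite ltrBlDr -ltrBlDl; apply: lt_le_trans HJ0 _; apply: ler_fset_sum.
Qed.

Lemma partial_sumD (M : zmodType) (f g : I -> M) :
  partial_sum (fun i => f i + g i) = partial_sum f \+ partial_sum g.
Proof. by apply/funext => J; rewrite /= !partial_sumE big_split. Qed.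

Lemma bounded_cvg_real (R : realType) (f : I -> R^o) :
  bounded_sums f -> cvg (partial_sum f @ totally).
Proof.
move=> [M HM].
(* Write f as the difference of the nonnegative families f + |f| and |f|, both of which have bounded
   sums. *)
have -> : f = (fun i => (f i + `|f i|) + - `|f i|) by apply/funext=> i; rewrite addrK.
rewrite partial_sumD; apply: is_cvgD.
  apply: nneg_bounded_cvg => [i|]; first by rewrite -lerBlDr sub0r lerNnormlW.
  exists (M + M) => J.
  have := lerD (HM J) (HM J); rewrite -big_split; apply: le_trans.
  by apply: ler_sum => i _ /=; apply: le_trans (ler_normD _ _) _; rewrite normr_id.
rewrite [X in X @ _](_ : _ = - partial_sum (fun i => `|f i| : R^o)); last first.
  by apply/funext => J; rewrite /= fctE !partial_sumE sumrN.
apply: is_cvgN; apply: nneg_bounded_cvg => //.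
by exists M => J; under eq_bigr do rewrite normr_id; exact: HM.
Qed.

Lemma norm_Re_le (R : realType) (z : R[i]) : `|complex.Re z| <= complex.Re `|z|.
Proof.
case: z => x y; rewrite normc_def /=.
by rewrite -sqrtr_sqr ler_wsqrtr// lerDl sqr_ge0.
Qed.

Lemma norm_Im_le (R : realType) (z : R[i]) : `|complex.Im z| <= complex.Re `|z|.
Proof.
case: z => x y; rewrite normc_def /=.
by rewrite -sqrtr_sqr ler_wsqrtr// lerDr sqr_ge0.
Qed.

Lemma bounded_cvg (R : realType) (F : scalar_field) (f : I -> (base_field R F)^o) :
  bounded_sums f -> cvg (partial_sum f @ totally).
Proof.
case: F f => /= f; first exact: bounded_cvg_real.
case=> -[M N] HM.
pose re i : R^o := complex.Re (f i).
pose im i : R^o := complex.Im (f i).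
have Hre : cvg (partial_sum re @ totally).
  apply: bounded_cvg_real; exists M => J.
  have := HM J; rewrite lecE /= => /andP[_]; apply: le_trans.
  rewrite raddf_sum /=; apply: ler_sum => i _.
  exact: (norm_Re_le (f i)).
have Him : cvg (partial_sum im @ totally).
  apply: bounded_cvg_real; exists M => J.
  have := HM J; rewrite lecE /= => /andP[_]; apply: le_trans.
  rewrite raddf_sum /=; apply: ler_sum => i _.
  exact: (norm_Im_le (f i)).
pose a := lim (partial_sum re @ totally).
pose b := lim (partial_sum im @ totally).
apply: (@cvgP _ _ ((a +i* b)%C : R[i]^o)); apply/cvgrPdist_lt => /= -[e e'].
rewrite ltcE /= => /andP[/eqP -> e0].
have e2 : 0 < e / 2 by rewrite divr_gt0.
move/cvgrPdist_lt: Hre => /(_ _ e2)/totally_nearP[J1 H1].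
move/cvgrPdist_lt: Him => /(_ _ e2)/totally_nearP[J2 H2].
apply: (near_totally (J0 := (J1 `|` J2)%fset)) => J; rewrite fsubUset => /andP[s1 s2].
have := ltrD (H1 _ s1) (H2 _ s2); rewrite -splitr -ltcR.
apply: le_lt_trans; rewrite !partial_sumE -/a -/b.
have -> : \sum_(i <- J) f i = ((\sum_(i <- J) re i) +i* (\sum_(i <- J) im i))%C.
  apply/eqP; rewrite eq_complex /= !raddf_sum /= ?eqxx//.
rewrite raddfD /=.
rewrite [X in `|X| <= _]complexE /=.
apply: le_trans (ler_normD _ _) _.
by rewrite normrM !normc_def /= expr0n expr1n add0r !addr0 sqrtr1 mul1r !sqrtr_sqr.
Qed.
End sums.

(** The order of [K] need not be total, but nonnegative elements are comparable, and the product is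
    at most the square of the larger one. *)
Lemma mul_le_sqrD (K : numDomainType) (a b : K) : 0 <= a -> 0 <= b ->
  a * b <= a ^+ 2 + b ^+ 2.
Proof.
move=> a0 b0; have := real_comparable (ger0_real a0) (ger0_real b0).
case/orP => ab.
  by apply: (@le_trans _ _ (b ^+ 2)); rewrite ?lerDr ?exprn_ge0// expr2 ler_wpM2r.
by apply: (@le_trans _ _ (a ^+ 2)); rewrite ?lerDl ?exprn_ge0// expr2 ler_wpM2l.
Qed.

Section dot.
Variables (R : realType) (F : scalar_field) (I : choiceType).
Local Notation K := (base_field R F).
Local Notation cj := (@base_conj R F).
Local Notation V := (I -> K^o).
Local Notation dot := (@ell2_dot R F I).
Local Notation ell2 := (@ell2 R F I).
Implicit Types (f g : I -> K^o) (u v w : V).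

Lemma bounded_sums_dom (g : I -> K) (f : I -> K) :
  (forall i, `|f i| <= `|g i|) -> bounded_sums g -> bounded_sums f.
Proof.
by move=> fg [M HM]; exists M => J; apply: le_trans (HM J); apply: ler_sum.
Qed.

Lemma bounded_sumsD (f g : I -> K) :
  bounded_sums f -> bounded_sums g -> bounded_sums (fun i => f i + g i).
Proof.
move=> [M HM] [N HN]; exists (M + N) => J.
apply: le_trans (lerD (HM J) (HN J)); rewrite -big_split /=.
by apply: ler_sum => i _; apply: ler_normD.
Qed.

Lemma bounded_sumsZ (a : K) (f : I -> K) :
  bounded_sums f -> bounded_sums (fun i => a * f i).
Proof.
move=> [M HM]; exists (`|a| * M) => J.
under eq_bigr do rewrite normrM.
by rewrite -mulr_sumr ler_wpM2l.
Qed.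

Lemma bounded_sums_finite (f : I -> K) (J0 : {fset I}) :
  (forall i, i \notin J0 -> f i = 0) -> bounded_sums f.
Proof.
move=> f0; exists (\sum_(i <- J0) `|f i|) => J.
rewrite (@fset_sum_subset I _ (fun i => `|f i|) J0 (J `|` J0)%fset) ?fsubsetUr//.
  by apply: ler_fset_sum => //; apply: fsubsetUl.
by move=> i _ /f0 ->; rewrite normr0.
Qed.

Lemma cvg_bounded_sums f :
  (forall i, 0 <= f i) -> cvg (partial_sum f @ totally) -> bounded_sums f.
Proof.
(* Beyond [J0] the sums are within 1 of the limit; by monotonicity any finite sum is at most one
   taken beyond [J0]. *)
move=> f0 /cvgrPdist_lt/(_ 1 ltr01)/totally_nearP[J0 H].
exists (`|lim (partial_sum f @ totally)| + 1) => J.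
under eq_bigr do rewrite ger0_norm//.
have := H (J0 `|` J)%fset (fsubsetUl _ _).
rewrite partial_sumE => /ltW Hd.
apply: (le_trans (ler_fset_sum f0 (fsubsetUr J0 J))).
rewrite -[leLHS]ger0_norm ?sumr_ge0//.
rewrite -[X in `|X| <= _](subKr (lim (partial_sum f @ totally))).
by apply: le_trans (ler_normB _ _) _; rewrite lerD2l.
Qed.

Lemma sum_cvg f : bounded_sums f -> partial_sum f @ totally --> sum f.
Proof. exact: bounded_cvg. Qed.

Lemma sum_unique f (l : K^o) : partial_sum f @ totally --> l -> sum f = l.
Proof. by move=> h; apply: cvg_lim h; apply: norm_hausdorff. Qed.

Lemma sumD f g : bounded_sums f -> bounded_sums g ->
  sum (fun i => f i + g i : K^o) = sum f + sum g.
Proof.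
move=> bf bg; apply: sum_unique; rewrite partial_sumD.
by apply: cvgD; apply: sum_cvg.
Qed.

Lemma sumZ (a : K) f : bounded_sums f -> sum (fun i => a * f i : K^o) = a * sum f.
Proof.
move=> bf; apply: sum_unique.
rewrite (_ : partial_sum _ = a \*: partial_sum f); last first.
  by apply/funext => J; rewrite /= !partial_sumE scaler_sumr.
by apply: cvgZr; apply: sum_cvg.
Qed.

Lemma sum_fset f (J0 : {fset I}) :
  (forall i, i \notin J0 -> f i = 0) -> sum f = \sum_(i <- J0) f i.
Proof.
move=> f0; apply: sum_unique; apply: cvg_near_cst.
apply: (near_totally (J0 := J0)) => J sJ; rewrite partial_sumE.
by rewrite -(fset_sum_subset sJ)// => i _; apply: f0.
Qed.

Lemma sum_ge0 f : (forall i, 0 <= f i) -> bounded_sums f -> 0 <= sum f.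
Proof.
move=> f0 bf.
have /cvg_norm h := sum_cvg bf.
suff -> : sum f = `|sum f| by [].
apply: sum_unique; apply: cvg_trans h; apply: near_eq_cvg.
by apply: nearW => J; rewrite partial_sumE ger0_norm// sumr_ge0.
Qed.

Lemma sum_conj f : bounded_sums f -> sum (fun i => cj (f i) : K^o) = cj (sum f).
Proof.
move=> bf; apply: sum_unique; apply/cvgrPdist_lt => e e0.
have /cvgrPdist_lt/(_ _ e0) := sum_cvg bf; apply: filterS => J.
rewrite -base_conj_norm !partial_sumE.
rewrite base_conjD base_conjN.
suff -> : cj (\sum_(i <- J) f i) = \sum_(i <- J) cj (f i) by [].
apply: (big_morph cj (@base_conjD R F)); exact: base_conj_ge0.
Qed.

Lemma sum_ge_fset f (J : {fset I}) : (forall i, 0 <= f i) -> bounded_sums f ->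
  \sum_(i <- J) f i <= sum f.
Proof.
move=> f0 bf.
pose g i : K^o := if i \in J then f i else 0.
pose h i : K^o := if i \in J then 0 else f i.
have bg : bounded_sums g.
  by apply: (bounded_sums_finite (J0 := J)) => i /negbTE; rewrite /g => ->.
have bh : bounded_sums h.
  apply: bounded_sums_dom bf => i; rewrite /h; case: ifP => // _.
  by rewrite normr0.
have -> : f = fun i => g i + h i.
  by apply/funext => i; rewrite /g /h; case: ifP; rewrite ?addr0 ?add0r.
rewrite sumD// (@sum_fset g J); last by move=> i /negbTE; rewrite /g => ->.
rewrite (_ : \sum_(i <- J) (g i + h i) = \sum_(i <- J) g i); last first.
  by rewrite [LHS]big_seq [RHS]big_seq; apply: eq_bigr => i iJ; rewrite /h iJ addr0.
rewrite lerDl sum_ge0// => i; rewrite /h; by case: ifP.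
Qed.

Lemma ell2P u : ell2 u <-> bounded_sums (fun x => `|u x| ^+ 2).
Proof.
split=> h; last exact: bounded_cvg.
by apply: cvg_bounded_sums => // i; rewrite exprn_ge0.
Qed.

Lemma ell2_0 : ell2 0.
Proof. by apply/ell2P; exists 0 => J; rewrite big1// => i _; rewrite normr0 expr0n normr0. Qed.

Lemma ell2D u v : ell2 u -> ell2 v -> ell2 (u + v).
Proof.
move=> /ell2P bu /ell2P bv; apply/ell2P.
(* The constant 3 comes from expanding the square of |u| + |v| and bounding the cross term 2|u||v|
   by twice the sum of squares, through [mul_le_sqrD]. *)
have := bounded_sumsZ 3 (bounded_sumsD bu bv); apply: bounded_sums_dom => i.
have p0 (a : K) : 0 <= `|a| ^+ 2 by rewrite exprn_ge0.
rewrite [leLHS]ger0_norm// [leRHS]ger0_norm ?mulr_ge0 ?addr_ge0//.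
apply: (@le_trans _ _ ((`|u i| + `|v i|) ^+ 2)).
  rewrite lerXn2r ?nnegrE ?addr_ge0//. exact: ler_normD.
rewrite sqrrD addrAC -[3]/(1 + 2)%:R natrD mulrDl mul1r lerD2l -mulr_natl.
by rewrite ler_wpM2l// mul_le_sqrD.
Qed.

Lemma ell2Z a u : ell2 u -> ell2 (a *: u).
Proof.
move=> /ell2P bu; apply/ell2P; have := bounded_sumsZ (`|a| ^+ 2) bu.
by apply: bounded_sums_dom => i; rewrite -exprMn -normrM.
Qed.

Lemma ell2_finite u (J : {fset I}) : (forall i, i \notin J -> u i = 0) -> ell2 u.
Proof.
move=> u0; apply/ell2P; apply: (bounded_sums_finite (J0 := J)) => i /u0 ->.
by rewrite normr0 expr0n.
Qed.

Lemma ell2N u : ell2 u -> ell2 (- u).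
Proof. by rewrite -scaleN1r; apply: ell2Z. Qed.

Lemma ell2B u v : ell2 u -> ell2 v -> ell2 (u - v).
Proof. by move=> eu ev; apply: ell2D => //; apply: ell2N. Qed.

Lemma ell2_sum (T : eqType) (s : seq T) (h : T -> V) :
  (forall i, i \in s -> ell2 (h i)) -> ell2 (\sum_(i <- s) h i).
Proof.
move=> eh; rewrite big_seq; apply: (big_ind ell2) => //; first exact: ell2_0.
exact: ell2D.
Qed.

Lemma dot_summable u v : ell2 u -> ell2 v -> bounded_sums (fun i => u i * cj (v i)).
Proof.
move=> /ell2P bu /ell2P bv; apply: bounded_sums_dom (bounded_sumsD bu bv) => i.
rewrite normrM base_conj_norm [leRHS]ger0_norm ?addr_ge0 ?exprn_ge0//.
by rewrite mul_le_sqrD.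
Qed.

Lemma dotDl u v w : ell2 u -> ell2 v -> ell2 w -> dot (u + v) w = dot u w + dot v w.
Proof.
move=> eu ev ew; rewrite /ell2_dot -sumD; try exact: dot_summable.
by congr sum; apply/funext => i; rewrite -mulrDl.
Qed.

Lemma dotZl a u w : ell2 u -> ell2 w -> dot (a *: u) w = a * dot u w.
Proof.
move=> eu ew; rewrite /ell2_dot -sumZ; last exact: dot_summable.
by congr sum; apply/funext => i; rewrite mulrA.
Qed.

Lemma dotC u v : ell2 u -> ell2 v -> dot v u = cj (dot u v).
Proof.
move=> eu ev; rewrite /ell2_dot -sum_conj; last exact: dot_summable.
by congr sum; apply/funext => i; rewrite base_conjM base_conjK mulrC.
Qed.

Lemma dotDr u v w : ell2 u -> ell2 v -> ell2 w -> dot w (u + v) = dot w u + dot w v.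
Proof.
move=> eu ev ew; rewrite dotC ?dotDl// ?base_conjD; try exact: ell2D.
by rewrite -!dotC.
Qed.

Lemma dotZr a u w : ell2 u -> ell2 w -> dot w (a *: u) = cj a * dot w u.
Proof.
move=> eu ew; rewrite dotC ?dotZl//; last exact: ell2Z.
by rewrite base_conjM -dotC.
Qed.

Lemma dotBl u v w : ell2 u -> ell2 v -> ell2 w -> dot (u - v) w = dot u w - dot v w.
Proof.
move=> eu ev ew; rewrite -scaleN1r dotDl//; last exact: ell2Z.
by rewrite dotZl// mulN1r.
Qed.

Lemma dotBr u v w : ell2 u -> ell2 v -> ell2 w -> dot w (u - v) = dot w u - dot w v.
Proof.
move=> eu ev ew; rewrite dotC ?dotBl//; last exact: ell2B.
by rewrite base_conjD base_conjN -!dotC.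
Qed.

Lemma dot0l w : dot 0 w = 0.
Proof.
rewrite /ell2_dot (@sum_fset _ fset0) ?big_seq_fset0 ?big_nil// => i _.
by rewrite mul0r.
Qed.

Lemma dot_sumr (T : eqType) (s : seq T) (h : T -> V) w :
  (forall i, i \in s -> ell2 (h i)) -> ell2 w ->
  dot w (\sum_(i <- s) h i) = \sum_(i <- s) dot w (h i).
Proof.
move=> eh ew; elim: s eh => [|t s IH] eh.
  rewrite !big_nil dotC ?dot0l ?base_conj_ge0//; exact: ell2_0.
rewrite !big_cons dotDr ?IH//.
- by move=> i si; apply: eh; rewrite in_cons si orbT.
- by apply: eh; rewrite mem_head.
- by apply: ell2_sum => i si; apply: eh; rewrite in_cons si orbT.
Qed.

Lemma dot_diag u : dot u u = sum (fun i => `|u i| ^+ 2 : K^o).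
Proof. by congr sum; apply/funext => i; rewrite mul_base_conj. Qed.

Lemma dot_ge0 u : ell2 u -> 0 <= dot u u.
Proof.
move=> /ell2P eu; rewrite dot_diag; apply: sum_ge0 => // i.
by rewrite exprn_ge0.
Qed.

Lemma dot_ge_fset u (J : {fset I}) : ell2 u -> \sum_(i <- J) `|u i| ^+ 2 <= dot u u.
Proof.
move=> /ell2P eu; rewrite dot_diag; apply: (@sum_ge_fset (fun i => `|u i| ^+ 2)) => //.
by move=> i; rewrite exprn_ge0.
Qed.

Lemma dot_ge_coord u x : ell2 u -> `|u x| ^+ 2 <= dot u u.
Proof. by move=> /(@dot_ge_fset _ [fset x]%fset); rewrite big_seq_fset1. Qed.

Lemma dot_disjoint u v : (forall i, u i = 0 \/ v i = 0) -> dot u v = 0.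
Proof.
move=> h; rewrite /ell2_dot (@sum_fset _ fset0) ?big_seq_fset0 ?big_nil// => i _.
case: (h i) => ->; first by rewrite mul0r.
by rewrite base_conj_ge0 ?mulr0.
Qed.

Definition unit_vec x : V := fun y => (y == x)%:R.

Lemma ell2_unit x : ell2 (unit_vec x).
Proof.
by apply: (@ell2_finite _ [fset x]%fset) => i; rewrite inE /unit_vec => /negbTE ->.
Qed.

Lemma dot_unit u x : dot u (unit_vec x) = u x.
Proof.
rewrite /ell2_dot (@sum_fset _ [fset x]%fset) ?big_seq_fset1.
  by rewrite /unit_vec eqxx base_conj_ge0 ?mulr1.
by move=> i; rewrite inE /unit_vec => /negbTE ->; rewrite base_conj_ge0 ?mulr0.
Qed.

(** Half of the parallelogram identity. It stands in for the triangle inequality, so that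
    approximation arguments can work with squared norms. *)
Lemma dotDD u v : ell2 u -> ell2 v -> dot (u + v) (u + v) <= 2 * (dot u u + dot v v).
Proof.
move=> eu ev; have euv := ell2D eu ev; have eumv := ell2B eu ev.
have -> : 2 * (dot u u + dot v v) = dot (u + v) (u + v) + dot (u - v) (u - v).
  rewrite (dotBl eu ev eumv) (dotBr eu ev eu) (dotBr eu ev ev).
  by rewrite (dotDl eu ev euv) (dotDr eu ev eu) (dotDr eu ev ev); ring.
by rewrite lerDl dot_ge0.
Qed.

(** One [J] serves every [v] obtained from [u] by erasing the coordinates in [J] and possibly more.
    This form covers both ladder tails and the error of a finite truncation. The bound is the full
    sum of squares minus its part over [J], represented by [g]. *)
Lemma dot_tail u (eps : K) : ell2 u -> 0 < eps ->
  exists J : {fset I}, forall v,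
    (forall i, v i = 0 \/ i \notin J /\ v i = u i) -> dot v v < eps.
Proof.
move=> /ell2P bu eps0; have /cvgrPdist_lt/(_ _ eps0)/totally_nearP[J H] := sum_cvg bu.
exists J => v hv.
have bv : bounded_sums (fun i => `|v i| ^+ 2).
  apply: bounded_sums_dom bu => i; case: (hv i) => [->|[_ ->]]//.
  by rewrite normr0 expr0n normr0.
pose g i : K^o := if i \in J then `|u i| ^+ 2 else 0.
have gJ i : i \notin J -> g i = 0 by rewrite /g => /negbTE ->.
have bg : bounded_sums g by exact: bounded_sums_finite gJ.
have gsum : sum g = \sum_(i <- J) `|u i| ^+ 2.
  by rewrite (sum_fset gJ) [LHS]big_seq [RHS]big_seq; apply: eq_bigr => i iJ; rewrite /g iJ.
have := H J (fsubset_refl _); rewrite partial_sumE -gsum; apply: le_lt_trans.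
rewrite dot_diag.
have -> : sum (fun i => `|u i| ^+ 2 : K^o) - sum g =
    sum (fun i => `|u i| ^+ 2 + (-1) * g i : K^o).
  by rewrite sumD ?sumZ ?mulN1r//; apply: bounded_sumsZ.
have hge i : `|v i| ^+ 2 <= `|u i| ^+ 2 + (-1) * g i.
  rewrite mulN1r /g; case: (hv i) => [->|[/negbTE -> ->]]; last by rewrite subr0.
  by rewrite normr0 expr0n/=; case: ifP; rewrite ?subrr// subr0 exprn_ge0.
have bd := bounded_sumsD bu (bounded_sumsZ (-1) bg).
apply: le_trans (real_ler_norm _); last first.
  by apply: ger0_real; apply: sum_ge0 => // i; apply: le_trans (hge i); rewrite exprn_ge0.
rewrite -subr_ge0 -[X in _ + X]mulN1r -sumZ// -sumD//; last exact: bounded_sumsZ.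
apply: sum_ge0 => [i|]; first by rewrite [X in 0 <= _ + X]mulN1r subr_ge0.
by apply: bounded_sumsD => //; apply: bounded_sumsZ.
Qed.
End dot.

Section span.
Variables (K : numFieldType) (V : lmodType K).
Implicit Types (E Y : set V).

Lemma span_mem E e : E e -> linear_span E e.
Proof.
by move=> Ee; exists 1%N, (fun=> 1), (fun=> e); split=> //; rewrite big_ord1 scale1r.
Qed.

Lemma span0 E : linear_span E 0.
Proof. by exists 0%N, (fun=> 1), (fun=> 0); split=> [[]//|]; rewrite big_ord0. Qed.

Lemma spanD E u v : linear_span E u -> linear_span E v -> linear_span E (u + v).
Proof.
move=> [n [a [e [Ee ->]]]] [m [b [f [Ef ->]]]].
exists (n + m)%N, (fun i => match fintype.split i with inl j => a j | inr j => b j end),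
  (fun i => match fintype.split i with inl j => e j | inr j => f j end); split.
  by move=> i; case: (fintype.split i).
rewrite big_split_ord /=; congr (_ + _); apply: eq_bigr => i _.
  by rewrite (unsplitK (inl i)).
by rewrite (unsplitK (inr i)).
Qed.

Lemma spanZ E c u : linear_span E u -> linear_span E (c *: u).
Proof.
move=> [n [a [e [Ee ->]]]]; exists n, (fun i => c * a i), e; split=> //.
by rewrite scaler_sumr; apply: eq_bigr => i _; rewrite scalerA.
Qed.

Lemma spanB E u v : linear_span E u -> linear_span E v -> linear_span E (u - v).
Proof. by move=> hu hv; rewrite -scaleN1r; apply: spanD => //; apply: spanZ. Qed.

Lemma span_sum (T : eqType) (s : seq T) (h : T -> V) E :
  (forall i, i \in s -> linear_span E (h i)) -> linear_span E (\sum_(i <- s) h i).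
Proof.
move=> eh; rewrite big_seq; apply: (big_ind (linear_span E)) => //; first exact: span0.
exact: spanD.
Qed.

Lemma span_min E Y : Y 0 -> (forall u v, Y u -> Y v -> Y (u + v)) ->
  (forall c u, Y u -> Y (c *: u)) -> E `<=` Y -> linear_span E `<=` Y.
Proof.
move=> Y0 YD YZ EY _ [n [a [e [Ee ->]]]].
by apply: (big_ind Y) => // i _; apply: YZ; apply: EY.
Qed.

Lemma span_sub E E' : E `<=` linear_span E' -> linear_span E `<=` linear_span E'.
Proof. by apply: span_min; [exact: span0|exact: spanD|exact: spanZ]. Qed.
End span.

(** * Orthogonal families and Bessel's inequality *)

Section dot_more.
Variables (R : realType) (F : scalar_field) (I : choiceType).
Local Notation K := (base_field R F).
Local Notation cj := (@base_conj R F).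
Local Notation V := (I -> K^o).
Local Notation dot := (@ell2_dot R F I).
Local Notation ell2 := (@ell2 R F I).
Local Notation unit_vec := (@unit_vec R F I).
Implicit Types (u v w : V).

Lemma sum_unit_vecE (c : I -> K) (J : {fset I}) y :
  (\sum_(x <- J) c x *: unit_vec x) y = if y \in J then c y else 0.
Proof.
rewrite fct_sumE; case: ifPn => yJ.
  rewrite (bigD1_seq y) ?fset_uniq//= big1 ?addr0.
    by rewrite -[LHS]/(_ * (y == y)%:R) eqxx mulr1.
  by move=> x /negbTE xy; rewrite -[LHS]/(_ * (y == x)%:R) eq_sym xy mulr0.
rewrite big_seq big1// => x xJ.
rewrite -[LHS]/(_ * (y == x)%:R); case: eqP => [yx|]; last by rewrite mulr0.
by move: yJ; rewrite yx xJ.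
Qed.

Lemma dotZZ a u : ell2 u -> dot (a *: u) (a *: u) = `|a| ^+ 2 * dot u u.
Proof.
move=> eu; rewrite dotZl ?dotZr//; last exact: ell2Z.
by rewrite mulrA mul_base_conj.
Qed.

Lemma dot_sym0 u v : ell2 u -> ell2 v -> dot u v = 0 -> dot v u = 0.
Proof. by move=> eu ev uv; rewrite dotC// uv base_conj_ge0. Qed.

(** Dividing by norms gives an orthonormal family with the same span. As this span is all of [Y],
    density is witnessed by the vector itself. *)
Lemma orthogonal_nonpathological (Y E : set V) :
  Y `<=` ell2 -> (forall c u, Y u -> Y (c *: u)) ->
  E `<=` Y -> Y `<=` linear_span E -> linear_span E `<=` Y ->
  (forall e, E e -> dot e e != 0) ->
  (forall e f, E e -> E f -> e <> f -> dot e f = 0) ->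
  nonpathological dot Y.
Proof.
move=> Yl YZ EY YE spY nz orth.
have El e : E e -> ell2 e by move=> /EY/Yl.
have /choice[r Hr] e : exists r : K, E e -> 0 < r /\ r ^+ 2 = dot e e.
  case: (pselect (E e)) => [Ee|]; last by exists 0.
  have [r r0 re] := base_sqrt (dot_ge0 (El e Ee)); exists r => _; split=> //.
  by rewrite lt_neqAle r0 andbT eq_sym -sqrf_eq0 re nz.
pose h e := (r e)^-1 *: e.
have rne e : E e -> r e != 0 by move=> /Hr[/gt_eqF->].
have spE : linear_span (h @` E) `<=` linear_span E.
  by apply: span_sub => _ [e Ee <-]; apply: spanZ; apply: span_mem.
exists (h @` E); split.
- by move=> _ [e Ee <-]; apply: YZ; apply: EY.
- split=> [_ [e Ee <-]|_ _ [e Ee <-] [f Ef <-] ef].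
    have [r0 re] := Hr e Ee.
    rewrite dotZZ; last exact: El.
    rewrite ger0_norm ?invr_ge0 ?ltW// -re exprVn mulVf// sqrf_eq0; exact: rne.
  have le := El e Ee; have lf := El f Ef; have lrf := @ell2Z _ _ _ (r f)^-1 _ lf.
  rewrite (dotZl _ le lrf) (dotZr _ lf le).
  by rewrite orth ?mulr0// => eqef; apply: ef; rewrite eqef.
- split; first by move=> v /spE/spY.
  move=> u Yu eps eps0; exists u; last by rewrite subrr dot0l exprn_gt0.
  have : linear_span E u by apply: YE.
  apply: span_sub => e Ee; rewrite -[e](@scalerKV _ _ _ (rne e Ee)).
  by apply: spanZ; apply: span_mem; exists e.
Qed.

Lemma bounded_sums_countable (J : choiceType) (f : J -> K) :
  (forall i, 0 <= f i) -> bounded_sums f -> countable [set i | f i != 0].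
Proof.
move=> f0 [M HM].
have M0 : 0 <= M by have := HM fset0; rewrite big_seq_fset0.
have [n Mn] : exists n : nat, M <= n%:R.
  have M1 : 0 < M + 1 by rewrite ltr_wpDl.
  have [|n Hn] := @base_archi R F (M + 1)^-1; first by rewrite invr_gt0.
  exists n; move: Hn; rewrite ler_pdivlMr// mul1r; apply: le_trans.
  by rewrite lerDl.
have -> : [set i | f i != 0] = \bigcup_(m in [set: nat]) [set i | 1 <= m%:R * f i].
  apply/seteqP; split=> i /=.
    move=> fi; have [|m Hm] := @base_archi R F (f i); last by exists m.
    by rewrite lt_neqAle eq_sym fi f0.
  by case=> m _ /=; apply: contraTneq => ->; rewrite mulr0 ler10.
apply: bigcup_countable => // m _; apply: finite_set_countable; apply: contrapT.
(* Since M is at most n, more than m * n indices with m * f i at least 1 would make m times their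
   sum exceed m * M. *)
move=> /(@infinite_set_fset _ _ (m * n).+1)[B HB cB].
have : ((m * n).+1%:R : K) <= (m * n)%:R.
  apply: (@le_trans _ _ (\sum_(i <- B) m%:R * f i)).
    apply: (@le_trans _ _ (\sum_(i <- B) 1)).
      by rewrite big_const_seq count_predT iter_addr_0 ler_nat.
    by rewrite [leLHS]big_seq [leRHS]big_seq; apply: ler_sum => i iB; apply: HB.
  rewrite -mulr_sumr natrM ler_wpM2l//; apply: le_trans Mn; apply: le_trans (HM B).
  by apply: ler_sum => i _; rewrite ger0_norm.
by rewrite ler_nat ltnn.
Qed.

Lemma countable_support u : ell2 u -> countable [set i | u i != 0].
Proof.
move=> /ell2P eu; have := bounded_sums_countable (fun i => exprn_ge0 2 (normr_ge0 (u i))) eu.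
apply: sub_countable; apply: subset_card_le => i /=.
by rewrite sqrf_eq0 normr_eq0.
Qed.

(** Let p be the projection of e_x to the span of [J]; its coefficients are the conjugates of b(x).
    Both (p, e_x) and (p, p) equal the sum s, so the squared norm of e_x - p is 1 - s, which is
    nonnegative. *)
Lemma bessel (B : set V) x (J : {fset V}) : B `<=` ell2 -> orthonormal_set dot B ->
  (forall b, b \in J -> B b) -> \sum_(b <- J) `|b x| ^+ 2 <= 1.
Proof.
move=> Bl [B1 B0] JB.
pose p := \sum_(b <- J) cj (b x) *: b.
pose s := \sum_(b <- J) `|b x| ^+ 2.
have Jl b : b \in J -> ell2 (cj (b x) *: b) by move=> /JB/Bl; apply: ell2Z.
have pl : ell2 p by apply: ell2_sum.
have s0 : 0 <= s by apply: sumr_ge0 => b _; rewrite exprn_ge0.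
have px : dot p (unit_vec x) = s.
  rewrite dot_unit /p fct_sumE; apply: eq_bigr => b _.
  by rewrite -[LHS]/(cj (b x) * b x) mulrC mul_base_conj.
have bp b : b \in J -> dot b p = b x.
  move=> bJ; have Bb := JB b bJ; rewrite dot_sumr//; last exact: Bl.
  rewrite (bigD1_seq b) ?fset_uniq//= big_seq_cond big1 ?addr0.
    by rewrite dotZr ?base_conjK ?B1 ?mulr1//; apply: Bl.
  move=> c /andP[cJ /eqP cb]; have Bc := JB c cJ.
  by rewrite (dotZr _ (Bl c Bc) (Bl b Bb)) B0 ?mulr0// => bc; apply: cb.
have pp : dot p p = s.
  rewrite {2}/p dot_sumr// [LHS]big_seq [RHS]big_seq; apply: eq_bigr => b bJ.
  have bl : ell2 b by apply: Bl; apply: JB.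
  by rewrite dotZr// base_conjK dotC// bp// mul_base_conj.
have ul := @ell2_unit R F I x.
have yl := ell2B ul pl; have := dot_ge0 yl.
rewrite (dotBl ul pl yl) (dotBr ul pl ul) (dotBr ul pl pl) pp px.
rewrite [dot (unit_vec x) p](dotC pl ul) px base_conj_ge0// dot_unit /unit_vec eqxx.
by rewrite subrr subr0 subr_ge0.
Qed.

End dot_more.

(** * The space spanned by the ladder vectors *)

Section ladder_space.
Variables (R : realType) (F : scalar_field) (d : Order.disp_t) (kappa : orderType d).
Local Notation K := (base_field R F).
Local Notation cj := (@base_conj R F).
Local Notation V := (kappa -> K^o).
Local Notation dot := (@ell2_dot R F kappa).
Local Notation ell2 := (@ell2 R F kappa).
Local Notation unit_vec := (@unit_vec R F kappa).
Variables (S : set kappa) (g : kappa -> nat -> kappa).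
Hypothesis g_inj : forall a, S a -> injective (g a).
Hypothesis g_lt : forall a n, S a -> (g a n < a)%O.
Hypothesis gS : forall a n, ~ S (g a n).

(** The argument uses that the weights are nonzero and square summable. Powers of 1/2 are moreover
    positive, hence fixed by conjugation, and their partial sums stay below 2. *)
Definition coef (n : nat) : K := 2^-1 ^+ n.

Lemma coef_gt0 n : 0 < coef n.
Proof. by rewrite exprn_gt0// invr_gt0 ltr0n. Qed.

Lemma coef_neq0 n : coef n != 0. Proof. by rewrite gt_eqF// coef_gt0. Qed.

Lemma conj_coef n : cj (coef n) = coef n.
Proof. by rewrite base_conj_ge0// ltW// coef_gt0. Qed.

Lemma sum_coef n : \sum_(k < n) coef k <= 2.
Proof.
suff -> : \sum_(k < n) coef k = 2 - 2 * coef n by rewrite gerBl mulr_ge0// ltW// coef_gt0.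
elim: n => [|n IH]; first by rewrite big_ord0 /coef expr0 mulr1 subrr.
rewrite big_ord_recr /= IH /coef exprS mulrA mulfV ?pnatr_eq0// mul1r.
by rewrite -addrA mulr_natl mulr2n opprD addrNK.
Qed.

(** The index k is picked by choice; for [a] in [S] it is unique by [g_inj]. *)
Definition ladder_tail (a : kappa) (n : nat) : V := fun x =>
  if pselect (exists k, (n <= k)%N /\ g a k = x) is left e
  then coef (projT1 (cid e)) else 0.

Lemma ladder_tail_g a n k : S a -> ladder_tail a n (g a k) = if (n <= k)%N then coef k else 0.
Proof.
move=> Sa; rewrite /ladder_tail; case: pselect => [e|ne].
  by case: (cid e) => j /= [nj /(g_inj Sa) <-]; rewrite nj.
by case: ifP => // nk; case: ne; exists k.
Qed.

Lemma ladder_tail0 a n x : (forall k, (n <= k)%N -> g a k <> x) -> ladder_tail a n x = 0.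
Proof. by rewrite /ladder_tail => h; case: pselect => // -[k [nk gk]]; case: (h k nk). Qed.

Lemma ladder_tail_neq0 a n x : ladder_tail a n x <> 0 -> exists k, (n <= k)%N /\ x = g a k.
Proof.
move=> h; apply: contrapT => ne; apply: h; apply: ladder_tail0 => k nk gk.
by apply: ne; exists k.
Qed.

Lemma ell2_ladder_tail a n : S a -> ell2 (ladder_tail a n).
Proof.
move=> Sa; apply/ell2P; exists 2 => J.
have /choice[idx Hidx] x : exists k, ladder_tail a n x <> 0 -> (n <= k)%N /\ x = g a k.
  case: (pselect (ladder_tail a n x = 0)) => [e|/ladder_tail_neq0[k hk]]; last by exists k.
  by exists 0%N.
(* [M] exceeds every rung index met in [J]. As coef k is at most 1, its square is at most coef k;
   summing over rungs first and exchanging the two sums leaves at most the sum of coef k for k below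
   [M]. *)
pose M := (\max_(x <- J) (idx x).+1)%N.
apply: le_trans (sum_coef M).
apply: (@le_trans _ _ (\sum_(x <- J) \sum_(k < M) (g a k == x)%:R * coef k)).
  rewrite [leLHS]big_seq [leRHS]big_seq; apply: ler_sum => x xJ.
  have pos (k : 'I_M) : 0 <= (g a k == x)%:R * coef k :> K.
    by rewrite mulr_ge0// ltW// coef_gt0.
  have [->|/eqP/Hidx[nk xg]] := eqVneq (ladder_tail a n x) 0.
    by rewrite normr0 expr0n normr0; apply: sumr_ge0.
  have kM : (idx x < M)%N by rewrite /M (big_rem x)//= leq_max leqnn.
  rewrite (bigD1 (Ordinal kM))//= -xg eqxx mul1r.
  rewrite {1}xg ladder_tail_g// nk.
  apply: (@le_trans _ _ (coef (idx x))); last by rewrite lerDl sumr_ge0.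
  have c0 := ltW (coef_gt0 (idx x)).
  rewrite (ger0_norm c0) expr2 (ger0_norm (mulr_ge0 c0 c0)) ler_piMr//.
  by apply: exprn_ile1; rewrite ?invr_ge0 ?ler0n// invf_le1 ?ltr0n// ler1n.
rewrite exchange_big /=; apply: ler_sum => k _.
rewrite -mulr_suml ler_piMl ?(ltW (coef_gt0 _))//.
case: (boolP (g a k \in J)) => gJ.
  rewrite (bigD1_seq (g a k)) ?fset_uniq//= eqxx big1 ?addr0//.
  by move=> x /negbTE; rewrite eq_sym => ->.
rewrite big_seq big1 ?ler01// => x xJ; case: eqP => // e.
by move: gJ; rewrite e xJ.
Qed.

(** This is u_a with its first [n] rungs erased; [n] = 0 gives u_a itself. *)
Definition ladder_vec (a : kappa) (n : nat) : V := unit_vec a + ladder_tail a n.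

Lemma ladder_vecE a n x : ladder_vec a n x = (x == a)%:R + ladder_tail a n x.
Proof. by []. Qed.

Lemma ell2_ladder_vec a n : S a -> ell2 (ladder_vec a n).
Proof. by move=> Sa; apply: ell2D; [apply: ell2_unit|apply: ell2_ladder_tail]. Qed.

Arguments ell2_ladder_vec [a] n _.

Lemma g_neq a k b : S b -> (g a k == b) = false.
Proof. by move=> Sb; apply/eqP => e; apply: (@gS a k); rewrite e. Qed.

Lemma ladder_vec_S a n b : S b -> ladder_vec a n b = (b == a)%:R.
Proof.
move=> Sb; rewrite ladder_vecE ladder_tail0 ?addr0// => k _ /eqP.
by rewrite g_neq.
Qed.

Lemma ladder_vec_g a n k : S a -> ladder_vec a n (g a k) = if (n <= k)%N then coef k else 0.
Proof. by move=> Sa; rewrite ladder_vecE ladder_tail_g// g_neq// add0r. Qed.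

Lemma ladder_vec_neq0 a n x : ladder_vec a n x <> 0 ->
  x = a \/ exists k, (n <= k)%N /\ x = g a k.
Proof.
rewrite ladder_vecE; have [->|_] := eqVneq x a; first by left.
by rewrite add0r => /ladder_tail_neq0; right.
Qed.

Lemma ladder_vec_rec a n : S a -> ladder_vec a n = coef n *: unit_vec (g a n) + ladder_vec a n.+1.
Proof.
move=> Sa; apply/funext => x.
rewrite -[RHS]/(coef n * (x == g a n)%:R + ((x == a)%:R + ladder_tail a n.+1 x)).
rewrite ladder_vecE addrCA.
congr (_ + _).
case: (pselect (exists k, x = g a k)) => [[k ->]|nx].
  rewrite !ladder_tail_g// (inj_eq (g_inj Sa)) leq_eqVlt eq_sym.
  have [->|_] := eqVneq k n; first by rewrite ltnn mulr1 addr0.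
  by rewrite mulr0 add0r.
rewrite !ladder_tail0; try by move=> k _ e; apply: nx; exists k.
by have [e|_] := eqVneq x (g a n); [case: nx; exists n|rewrite mulr0 addr0].
Qed.

Definition generators (T : set kappa) : set V :=
  [set unit_vec x | x in T `\` S] `|` [set ladder_vec a 0 | a in T `&` S].

Definition ladder_space : set V := linear_span (generators setT).

Lemma ladder_space_ell2 : ladder_space `<=` ell2.
Proof.
apply: span_min; [exact: ell2_0|by move=> u v; apply: ell2D|by move=> c u; apply: ell2Z|].
by move=> _ [[x _ <-]|[a [_ Sa] <-]]; [exact: ell2_unit|exact: ell2_ladder_vec].
Qed.

(** What is left of [v] after removing its u_a components, the coefficient of u_a being v(a). [J] is
    meant to contain the points of [S] where [v] is nonzero. *)
Definition remainder (v : V) (J : {fset kappa}) : V :=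
  v - \sum_(a <- J) v a *: ladder_vec a 0.

Lemma sum_vecE (T : Type) (s : seq T) (h : T -> V) x :
  (\sum_(i <- s) h i) x = \sum_(i <- s) h i x.
Proof. by rewrite fct_sumE. Qed.

(** The property holds for the generators and is preserved by linear operations. For sums, [ext]
    lets both vectors use the union of their sets [J]: enlarging [J] inside [S] adds only terms with
    coefficient 0. *)
Lemma ladder_space_decomp v : ladder_space v -> exists J J0 : {fset kappa},
  [/\ forall a, a \in J -> S a, forall a, S a -> v a <> 0 -> a \in J
    & forall x, x \notin J0 -> remainder v J x = 0].
Proof.
move: v; have ext v (J J' : {fset kappa}) :
    (J `<=` J')%fset -> (forall a, a \in J' -> S a) ->
    (forall a, S a -> v a <> 0 -> a \in J) -> remainder v J = remainder v J'.
  move=> sJ JS vJ; rewrite /remainder (fset_sum_subset sJ)// => a /JS Sa aJ.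
  have [->|/eqP/(vJ a Sa)] := eqVneq (v a) 0; first by rewrite scale0r.
  by rewrite (negbTE aJ).
apply: (@span_min _ _ _ [set v | exists J J0 : {fset kappa},
    [/\ forall a, a \in J -> S a, forall a, S a -> v a <> 0 -> a \in J
      & forall x, x \notin J0 -> remainder v J x = 0]]) => /=.
- exists fset0, fset0; split=> //.
  by move=> x _; rewrite /remainder big_seq_fset0 subr0.
- move=> u v [Ju [Ju0 [Su uJ ru]]] [Jv [Jv0 [Sv vJ rv]]].
  have SJ a : a \in (Ju `|` Jv)%fset -> S a by rewrite inE => /orP[/Su|/Sv].
  exists (Ju `|` Jv)%fset, (Ju0 `|` Jv0)%fset; split => //.
    move=> a Sa uv; rewrite inE; apply/orP.
    have [u0|/eqP/(uJ a Sa)] := eqVneq (u a) 0; last by left.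
    right; apply: vJ => // v0; apply: uv.
    by rewrite -[LHS]/(u a + v a) u0 v0 addr0.
  move=> x; rewrite inE negb_or => /andP[/ru xu /rv xv].
  have -> : remainder (u + v) (Ju `|` Jv)%fset = remainder u Ju + remainder v Jv.
    rewrite (ext u _ _ (fsubsetUl Ju Jv))// (ext v _ _ (fsubsetUr Ju Jv))//.
    rewrite /remainder addrACA -opprD; congr (_ - _); rewrite -big_split /=.
    by apply: eq_bigr => a _; rewrite -scalerDl.
  by rewrite -[LHS]/(remainder u Ju x + remainder v Jv x) xu xv addr0.
- move=> c u [J [J0 [SJ uJ ru]]]; exists J, J0; split=> //.
    move=> a Sa cu; apply: uJ => // u0; apply: cu.
    by rewrite -[LHS]/(c * u a) u0 mulr0.
  move=> x /ru xu.
  have -> : remainder (c *: u) J = c *: remainder u J.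
    rewrite /remainder scalerBr scaler_sumr; congr (_ - _).
    by apply: eq_bigr => a _; rewrite scalerA.
  by rewrite -[LHS]/(c * remainder u J x) xu mulr0.
move=> _ [[x [_ nSx] <-]|[a [_ Sa] <-]].
  exists fset0, [fset x]%fset; split=> //.
    move=> a Sa; rewrite /unit_vec; case: eqP => // ax; by case: nSx; rewrite -ax.
  move=> y; rewrite inE /remainder big_seq_fset0 subr0 => /negbTE yx.
  by rewrite /unit_vec yx.
exists [fset a]%fset, fset0; split=> //.
- by move=> b; rewrite inE => /eqP ->.
- by move=> b Sb; rewrite ladder_vec_S// inE; case: eqP.
- move=> x _; rewrite /remainder big_seq_fset1 ladder_vec_S// eqxx scale1r.
  by rewrite subrr.
Qed.

Lemma remainderE v J x :
  remainder v J x = v x - \sum_(a <- J) v a * ladder_vec a 0 x.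
Proof. by rewrite -[LHS]/(v x - (\sum_(a <- J) _) x) sum_vecE. Qed.

Lemma remainder_S v (J : {fset kappa}) x : (forall a, S a -> v a <> 0 -> a \in J) ->
  S x -> remainder v J x = 0.
Proof.
move=> vJ Sx; rewrite remainderE.
have [xJ|xJ] := boolP (x \in J).
  rewrite (bigD1_seq x) ?fset_uniq//= ladder_vec_S// eqxx mulr1 big1 ?addr0 ?subrr//.
  by move=> a /negbTE; rewrite ladder_vec_S// eq_sym => ->; rewrite mulr0.
have -> : v x = 0 by apply: contrapT => /(vJ x Sx); apply/negP.
rewrite sub0r big_seq big1 ?oppr0// => a aJ.
rewrite ladder_vec_S//; case: eqP => [xa|]; last by rewrite mulr0.
by move: xJ; rewrite xa aJ.
Qed.

Definition restricted T := restrict_supp ladder_space T.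

(** If u_a occurs in v, then v(a) is nonzero, so a is in [T], and closure puts its whole ladder in
    [T]. The remainder is therefore supported in [T] too; as it is finitely supported and vanishes
    on [S], it is a combination of the admissible unit vectors. *)
Lemma restricted_generators T : ladder_closed S g T ->
  restricted T `<=` linear_span (generators T).
Proof.
move=> Tc v [/ladder_space_decomp[J [J0 [JS vJ rJ0]]] vT].
have vT' x : v x <> 0 -> T x by move=> /eqP; apply: vT.
have -> : v = remainder v J + \sum_(a <- J) v a *: ladder_vec a 0 by rewrite subrK.
apply: spanD; last first.
  apply: span_sum => a aJ; have [->|/eqP/vT' Ta] := eqVneq (v a) 0.
    by rewrite scale0r; apply: span0.
  by apply: spanZ; apply: span_mem; right; exists a => //; split => //; apply: JS.
have -> : remainder v J = \sum_(x <- J0) remainder v J x *: unit_vec x.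
  by apply/funext => y; rewrite sum_unit_vecE; case: ifPn => // /rJ0.
apply: span_sum => x _; have [->|/eqP rx] := eqVneq (remainder v J x) 0.
  by rewrite scale0r; apply: span0.
apply: spanZ; apply: span_mem; left; exists x => //; split; last first.
  by move=> Sx; apply: rx; apply: remainder_S.
apply: contrapT => nTx; apply: rx; rewrite remainderE.
have -> : v x = 0 by apply: contrapT => /vT'.
rewrite sub0r big_seq big1 ?oppr0// => a aJ.
have [->|/eqP/vT' Ta] := eqVneq (v a) 0; first by rewrite mul0r.
suff -> : ladder_vec a 0 x = 0 by rewrite mulr0.
apply: contrapT => /ladder_vec_neq0[xa|[k [_ xk]]]; apply: nTx; first by rewrite xa.
by rewrite xk; apply: Tc => //; apply: JS.
Qed.

Lemma restrictedD T u v : restricted T u -> restricted T v -> restricted T (u + v).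
Proof.
move=> [Xu uT] [Xv vT]; split; first exact: spanD.
move=> x; rewrite /supp /= => h.
have [u0|/uT//] := eqVneq (u x) 0; apply: vT; rewrite /supp /=.
by move: h; rewrite -[(u + v) x]/(u x + v x) u0 add0r.
Qed.

Lemma restrictedZ T c u : restricted T u -> restricted T (c *: u).
Proof.
move=> [Xu uT]; split; first exact: spanZ.
move=> x; rewrite /supp /= => h; apply: uT; rewrite /supp /=.
by apply: contraNneq h => u0; rewrite -[(c *: u) x]/(c * u x) u0 mulr0.
Qed.

Lemma restricted0 T : restricted T 0.
Proof. by split; [exact: span0|move=> x; rewrite /supp /= eqxx]. Qed.

Lemma generators_restricted T : ladder_closed S g T ->
  linear_span (generators T) `<=` restricted T.
Proof.
move=> Tc; apply: span_min; [exact: restricted0|exact: restrictedD|exact: restrictedZ|].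
move=> _ [[x [Tx nSx] <-]|[a [Ta Sa] <-]]; split.
- by apply: span_mem; left; exists x.
- by move=> y; rewrite /supp /= /unit_vec; case: (y =P x) => [->//|]; rewrite eqxx.
- by apply: span_mem; right; exists a.
- move=> y; rewrite /supp /= => /eqP/ladder_vec_neq0[->//|[k [_ ->]]].
  exact: Tc.
Qed.

(* Gram-Schmidt applied to ladder_vec a 0 and the unit vectors at the rungs, up
   to normalization. *)
Definition ladder_gs (a : kappa) (k : nat) : V :=
  let w := ladder_vec a k.+1 in dot w w *: unit_vec (g a k) - coef k *: w.

Lemma dot_ladder_vec_gt0 a k : S a -> 0 < dot (ladder_vec a k) (ladder_vec a k).
Proof.
move=> Sa; apply: (lt_le_trans _ (dot_ge_coord a (ell2_ladder_vec k Sa))).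
by rewrite ladder_vec_S// eqxx normr1 expr1n.
Qed.

Lemma ell2_ladder_gs a k : S a -> ell2 (ladder_gs a k).
Proof.
by move=> Sa; apply: ell2B; apply: ell2Z; [apply: ell2_unit|apply: ell2_ladder_vec].
Qed.

Arguments ell2_ladder_gs [a] k _.

Lemma ladder_gsE a k x : ladder_gs a k x =
  dot (ladder_vec a k.+1) (ladder_vec a k.+1) * (x == g a k)%:R
  - coef k * ladder_vec a k.+1 x.
Proof. by []. Qed.

Lemma ladder_gs_g a k j : S a -> (j <= k)%N -> ladder_gs a k (g a j) =
  if j == k then dot (ladder_vec a k.+1) (ladder_vec a k.+1) else 0.
Proof.
move=> Sa jk; rewrite ladder_gsE ladder_vec_g// ltnNge jk /= mulr0 subr0.
by rewrite (inj_eq (g_inj Sa)); case: eqP; rewrite ?mulr1 ?mulr0.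
Qed.

Lemma ladder_gs_neq0 a k x : ladder_gs a k x <> 0 ->
  x = a \/ exists j, (k <= j)%N /\ x = g a j.
Proof.
rewrite ladder_gsE; case: eqP => [->|_]; first by right; exists k.
rewrite mulr0 sub0r => h; have /ladder_vec_neq0[->|[j [kj ->]]] : ladder_vec a k.+1 x <> 0.
- by move=> e; apply: h; rewrite e mulr0 oppr0.
- by left.
- by right; exists j; split=> //; apply: ltnW.
Qed.

(** Downward induction from j = k. At j = k the two contributions, coef k times the squared norm of
    [ladder_vec a k.+1], cancel; each smaller j adds a rung at which [ladder_gs a k] vanishes. *)
Lemma dot_gs_vec a j k : S a -> (j <= k)%N -> dot (ladder_gs a k) (ladder_vec a j) = 0.
Proof.
move=> Sa jk; have tl := ell2_ladder_gs k Sa.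
have ul j' : ell2 (unit_vec (g a j')) := @ell2_unit R F kappa (g a j').
have wl j' := ell2_ladder_vec j' Sa.
have cl c j' : ell2 (c *: unit_vec (g a j')) by apply: ell2Z.
rewrite -(subKn jk); elim: (k - j)%N => [|i IH].
  rewrite subn0 ladder_vec_rec// (dotDr (cl _ _) (wl _) tl) (dotZr _ (ul _) tl).
  rewrite dot_unit ladder_gs_g// eqxx conj_coef.
  have cwl : ell2 (coef k *: ladder_vec a k.+1) by apply: ell2Z.
  rewrite /ladder_gs (dotBl (cl _ _) cwl (wl _)) !dotZl//.
  rewrite (_ : dot (unit_vec (g a k)) _ = 0); first by rewrite mulr0 add0r subrr.
  apply: (dot_sym0 (wl _) (ul _)).
  by rewrite dot_unit ladder_vec_g// ltnn.
(* Once i reaches k the truncated subtraction stays at 0, and the claim repeats the induction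
   hypothesis. *)
have [ki|ik] := leqP k i.
  have /eqP e : (k - i == 0)%N by rewrite subn_eq0.
  by rewrite subnS e; rewrite e in IH.
rewrite ladder_vec_rec// (dotDr (cl _ _) (wl _) tl).
rewrite subnSK// IH addr0 (dotZr _ (ul _) tl) dot_unit ladder_gs_g ?leq_subr//.
by rewrite [(_ - _)%N == k]ltn_eqF ?mulr0// ltn_subrL (leq_ltn_trans (leq0n i) ik).
Qed.

Lemma dot_gs_gs a j k : S a -> (j < k)%N -> dot (ladder_gs a k) (ladder_gs a j) = 0.
Proof.
move=> Sa jk; have tl := ell2_ladder_gs k Sa; have wl := ell2_ladder_vec j.+1 Sa.
have ul : ell2 (unit_vec (g a j)) := @ell2_unit R F kappa (g a j).
rewrite {2}/ladder_gs dotBr//; try exact: ell2Z.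
rewrite !dotZr// dot_gs_vec// mulr0 subr0 dot_unit ladder_gs_g ?(ltnW jk)//.
by rewrite ltn_eqF// mulr0.
Qed.

Lemma dot_gs_neq0 a k : S a -> dot (ladder_gs a k) (ladder_gs a k) != 0.
Proof.
move=> Sa; rewrite gt_eqF//.
apply: (lt_le_trans _ (dot_ge_coord (g a k) (ell2_ladder_gs k Sa))).
by rewrite ladder_gs_g// eqxx exprn_gt0// normr_gt0 gt_eqF// dot_ladder_vec_gt0.
Qed.

(** * Orthogonal bases when the tails are disjoint *)

Section disjoint_tails.
Variables (T : set kappa) (N : kappa -> nat).
Hypothesis T_closed : ladder_closed S g T.
Hypothesis N_free : forall a a' j k, T a -> T a' -> S a -> S a' ->
  (N a <= j)%N -> (N a' <= k)%N -> g a j = g a' k -> a = a'.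

Definition block (a : kappa) : set V :=
  [set ladder_vec a (N a)] `|` [set ladder_gs a k | k in [set k | (N a <= k)%N]].

(** These include early rungs, of index below [N a], unless they lie on the retained tail of another
    ladder, whose block then accounts for them. *)
Definition free_units : set V :=
  [set unit_vec x | x in [set x | [/\ T x, ~ S x &
     forall a k, T a -> S a -> (N a <= k)%N -> g a k <> x]]].

Definition orth_family : set V := free_units `|` \bigcup_(a in T `&` S) block a.

Lemma block_neq0 a u x : block a u -> u x <> 0 ->
  x = a \/ exists k, (N a <= k)%N /\ x = g a k.
Proof.
move=> [->|[k /= Nk <-]]; first exact: ladder_vec_neq0.
move=> /ladder_gs_neq0[->|[j [kj ->]]]; [by left|right].
by exists j; split=> //; apply: leq_trans kj.
Qed.

Lemma block_ell2 a u : S a -> block a u -> ell2 u.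
Proof. by move=> Sa [->|[k _ <-]]; [apply: ell2_ladder_vec|apply: ell2_ladder_gs]. Qed.

Lemma dot_block a u v : S a -> block a u -> block a v -> u <> v -> dot u v = 0.
Proof.
move=> Sa [->|[k /= Nk <-]] [->|[j /= Nj <-]] // ne.
- by apply: dot_sym0; [exact: ell2_ladder_gs|exact: ell2_ladder_vec|exact: dot_gs_vec].
- exact: dot_gs_vec.
- case: (ltngtP k j) => [kj|jk|kj]; last by case: ne; rewrite kj.
    by apply: dot_sym0; [exact: ell2_ladder_gs|exact: ell2_ladder_gs|exact: dot_gs_gs].
  exact: dot_gs_gs.
Qed.

Lemma disjoint_dot u v : (forall x, u x <> 0 -> v x <> 0 -> False) -> dot u v = 0.
Proof.
move=> h; apply: dot_disjoint => x; have [|/eqP ux] := eqVneq (u x) 0; first by left.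
by right; apply: contrapT => vx; apply: (h x).
Qed.

Lemma dot_free_block x a v : T x -> ~ S x ->
  (forall a k, T a -> S a -> (N a <= k)%N -> g a k <> x) -> T a -> S a ->
  block a v -> dot (unit_vec x) v = 0.
Proof.
move=> Tx nSx nx Ta Sa bv; apply: disjoint_dot => y.
rewrite /unit_vec; case: eqP => // -> _ /(block_neq0 bv)[xa|[k [Nk xk]]].
  by apply: nSx; rewrite xa.
by apply: (nx a k).
Qed.

Lemma dot_orth_family u v : orth_family u -> orth_family v -> u <> v -> dot u v = 0.
Proof.
move=> [[x [Tx nSx nx] <-]|[a [Ta Sa] bu]] [[y [Ty nSy ny] <-]|[b [Tb Sb] bv]] ne.
- rewrite dot_unit /unit_vec; case: eqP => // yx; by case: ne; rewrite yx.
- exact: dot_free_block bv.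
- apply: dot_sym0; [exact: ell2_unit|exact: block_ell2 bu|exact: dot_free_block bu].
have [eab|/eqP nab] := eqVneq a b.
  by apply: (dot_block Sa) => //; rewrite eab.
apply: disjoint_dot => x /(block_neq0 bu) hu /(block_neq0 bv) hv.
case: hu => [xa|[k [Nk xk]]]; case: hv => [xb|[j [Nj xj]]].
- by apply: nab; rewrite -xa.
- by apply: (@gS b j); rewrite -xj xa.
- by apply: (@gS a k); rewrite -xk xb.
- by apply: nab; apply: (N_free Ta Tb Sa Sb Nk Nj); rewrite -xk.
Qed.

(** The vectors [ladder_gs a j] and coef j times [ladder_vec a j] add up to a multiple of e_(g a j),
    the factor being the squared norm of [ladder_vec a j]. Subtracting the recovered rung from
    [ladder_vec a j] gives the next ladder vector, and the process continues upwards from [N a]. *)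
Lemma span_block a k : T a -> S a -> (N a <= k)%N ->
  linear_span orth_family (ladder_vec a k) /\ linear_span orth_family (unit_vec (g a k)).
Proof.
move=> Ta Sa; have step j : (N a <= j)%N -> linear_span orth_family (ladder_vec a j) ->
    linear_span orth_family (unit_vec (g a j)).
  move=> Nj hj; pose W := dot (ladder_vec a j.+1) (ladder_vec a j.+1).
  have W0 : W + coef j * coef j != 0.
    by rewrite gt_eqF// addr_gt0 ?mulr_gt0 ?coef_gt0// dot_ladder_vec_gt0.
  rewrite -[unit_vec _](scalerK W0); apply: spanZ.
  have -> : (W + coef j * coef j) *: unit_vec (g a j) = ladder_gs a j + coef j *: ladder_vec a j.
    rewrite (ladder_vec_rec j Sa) /ladder_gs -/W; move: (ladder_vec a j.+1) => w.
    by rewrite scalerDr scalerA scalerDl addrACA addNr addr0.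
  apply: spanD; last exact: spanZ.
  by apply: span_mem; right; exists a => //; right; exists j.
move=> Nk; suff h : linear_span orth_family (ladder_vec a k) by split=> //; apply: step.
rewrite -(subnKC Nk); elim: (k - N a)%N => [|i IH].
  by rewrite addn0; apply: span_mem; right; exists a => //; left.
rewrite addnS; have -> : ladder_vec a (N a + i).+1 =
    ladder_vec a (N a + i) - coef (N a + i) *: unit_vec (g a (N a + i)).
  by rewrite [in RHS]ladder_vec_rec// addrAC subrr add0r.
by apply: spanB => //; apply: spanZ; apply: step => //; apply: leq_addr.
Qed.

Lemma generators_span_orth : generators T `<=` linear_span orth_family.
Proof.
have hx x : T x -> ~ S x -> linear_span orth_family (unit_vec x).
  move=> Tx nSx; case: (pselect (exists a k, [/\ T a, S a, (N a <= k)%N & g a k = x])).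
    by move=> [a [k [Ta Sa Nk <-]]]; apply: (span_block Ta Sa Nk).2.
  move=> nx; apply: span_mem; left; exists x => //; split=> // a k Ta Sa Nk gx.
  by apply: nx; exists a, k.
move=> _ [[x [Tx nSx] <-]|[a [Ta Sa] <-]]; first exact: hx.
have : linear_span orth_family (ladder_vec a (N a)) by apply: (span_block Ta Sa (leqnn _)).1.
(* Descend from the cut-off to 0, restoring one rung at a time; each rung is in [T] by closure and
   outside [S], so [hx] applies to it. *)
elim: (N a) => // n IH h; apply: IH; rewrite ladder_vec_rec//.
by apply: spanD => //; apply: spanZ; apply: hx; [apply: T_closed|exact: gS].
Qed.

Lemma orth_span_generators : linear_span orth_family `<=` linear_span (generators T).
Proof.
have hx x : T x -> ~ S x -> linear_span (generators T) (unit_vec x).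
  by move=> Tx nSx; apply: span_mem; left; exists x.
apply: span_sub => u [[x [Tx nSx _] <-]|[a [Ta Sa] bu]]; first exact: hx.
have hw n : linear_span (generators T) (ladder_vec a n).
  elim: n => [|n IH]; first by apply: span_mem; right; exists a.
  have -> : ladder_vec a n.+1 = ladder_vec a n - coef n *: unit_vec (g a n).
    by rewrite [in RHS]ladder_vec_rec// addrAC subrr add0r.
  by apply: spanB => //; apply: spanZ; apply: hx; [apply: T_closed|exact: gS].
case: bu => [->//|[k _ <-]]; rewrite /ladder_gs; apply: spanB; apply: spanZ => //.
by apply: hx; [apply: T_closed|exact: gS].
Qed.

Lemma restricted_nonpathological : nonpathological dot (restricted T).
Proof.
apply: (@orthogonal_nonpathological _ _ _ _ orth_family).
- by move=> u [/ladder_space_ell2].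
- exact: restrictedZ.
- by move=> u hu; apply: generators_restricted => //; apply: orth_span_generators; apply: span_mem.
- move=> u /(restricted_generators T_closed); apply: span_sub; exact: generators_span_orth.
- by move=> u /orth_span_generators; apply: generators_restricted.
- move=> u [[x _ <-]|[a [_ Sa] [->|[k _ <-]]]].
  + by rewrite dot_unit /unit_vec eqxx oner_eq0.
  + by rewrite gt_eqF// dot_ladder_vec_gt0.
  + exact: dot_gs_neq0.
- exact: dot_orth_family.
Qed.
End disjoint_tails.

(** * Density in l2 *)

Local Notation X := ladder_space.

Lemma eventually_notin a (J : {fset kappa}) : S a ->
  exists n, forall k, (n <= k)%N -> g a k \notin J.
Proof.
move=> Sa; have /choice[idx Hidx] x : exists k, forall j, g a j = x -> j = k.
  case: (pselect (exists k, g a k = x)) => [[k <-]|nk]; last first.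
    by exists 0%N => j gj; case: nk; exists j.
  by exists k => j /(g_inj Sa).
exists (\max_(x <- J) (idx x).+1)%N => k; apply: contraL => kJ.
by rewrite -ltnNge (big_rem (g a k))//= leq_max -(Hidx (g a k) k erefl) leqnn.
Qed.

(** The closure of X in l2, with [eps] bounding the squared distance so that no square roots are
    needed. *)
Definition in_closure (v : V) : Prop := ell2 v /\
  forall eps : K, 0 < eps -> exists2 x, X x & dot (v - x) (v - x) < eps.

Lemma in_closureD u v : in_closure u -> in_closure v -> in_closure (u + v).
Proof.
move=> [ul hu] [vl hv]; split; first exact: ell2D.
move=> eps e0; have e4 : 0 < eps / 4 by rewrite divr_gt0.
have [x Xx xu] := hu _ e4; have [y Xy yv] := hv _ e4.
exists (x + y); first exact: spanD.
have xl := ladder_space_ell2 Xx; have yl := ladder_space_ell2 Xy.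
have -> : u + v - (x + y) = (u - x) + (v - y) by rewrite opprD addrACA.
apply: (le_lt_trans (dotDD (ell2B ul xl) (ell2B vl yl))).
apply: (@lt_le_trans _ _ (2 * (eps / 4 + eps / 4))).
  by rewrite ltr_pM2l ?ltr0n// ltrD.
rewrite (_ : 2 * (eps / 4 + eps / 4) = eps)//.
by field.
Qed.

Lemma in_closureZ c u : in_closure u -> in_closure (c *: u).
Proof.
move=> [ul hu]; split; first exact: ell2Z.
move=> eps e0; have c1 : 0 < `|c| ^+ 2 + 1 by rewrite ltr_wpDl ?exprn_ge0.
have [|x Xx xu] := hu (eps / (`|c| ^+ 2 + 1)); first by rewrite divr_gt0.
have xl := ladder_space_ell2 Xx.
exists (c *: x); first exact: spanZ.
have uxl := ell2B ul xl.
rewrite -scalerBr dotZZ//.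
apply: (@le_lt_trans _ _ ((`|c| ^+ 2 + 1) * dot (u - x) (u - x))).
  by rewrite ler_wpM2r ?dot_ge0// lerDl.
by rewrite mulrC -ltr_pdivlMr.
Qed.

Lemma in_closure_space u : X u -> in_closure u.
Proof.
move=> Xu; split; first exact: ladder_space_ell2 Xu.
by move=> eps e0; exists u; rewrite ?subrr ?dot0l.
Qed.

Lemma ladder_vec_in_space a n : S a -> X (ladder_vec a n).
Proof.
move=> Sa; elim: n => [|n IH]; first by apply: span_mem; right; exists a.
have -> : ladder_vec a n.+1 = ladder_vec a n - coef n *: unit_vec (g a n).
  by rewrite [in RHS]ladder_vec_rec// addrAC subrr add0r.
by apply: spanB => //; apply: spanZ; apply: span_mem; left; exists (g a n).
Qed.

(** For [x] in [S], the vectors [ladder_vec x n] belong to X and differ from e_x by a tail of the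
    ladder, whose norm tends to 0. *)
Lemma unit_vec_in_closure x : in_closure (unit_vec x).
Proof.
case: (pselect (S x)) => Sx; last first.
  by apply: in_closure_space; apply: span_mem; left; exists x.
split; first exact: ell2_unit.
move=> eps e0.
have tl : ell2 (- ladder_tail x 0) by apply: ell2N; exact: ell2_ladder_tail.
have [J HJ] := dot_tail tl e0.
have [n Hn] := eventually_notin J Sx.
exists (ladder_vec x n); first exact: ladder_vec_in_space.
have -> : unit_vec x - ladder_vec x n = - ladder_tail x n.
  by rewrite /ladder_vec opprD addrA subrr add0r.
apply: HJ => y; case: (pselect (exists k, (n <= k)%N /\ g x k = y)) => [[k [nk <-]]|ny].
  right; split; first exact: Hn.
  rewrite -[LHS]/(- (ladder_tail x n (g x k))) -[RHS]/(- (ladder_tail x 0 (g x k))).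
  by rewrite !ladder_tail_g// nk.
left; rewrite -[LHS]/(- (ladder_tail x n y)) ladder_tail0 ?oppr0// => k nk gy.
by apply: ny; exists k.
Qed.

Lemma ladder_space_dense : norm_dense_in dot ell2 X.
Proof.
split; first exact: ladder_space_ell2.
move=> u ul eps e0.
have e2 : 0 < eps ^+ 2 / 4 by rewrite divr_gt0// exprn_gt0.
have [J HJ] := dot_tail ul e2.
pose u' : V := \sum_(x <- J) u x *: unit_vec x.
have u'E y : u' y = if y \in J then u y else 0 by rewrite /u' sum_unit_vecE.
have [u'l hu'] : in_closure u'.
  rewrite /u'; apply: (big_ind in_closure); [|exact: in_closureD|].
    by apply: in_closure_space; exact: span0.
  by move=> x _; apply: in_closureZ; exact: unit_vec_in_closure.
have [x Xx xu'] := hu' _ e2; exists x => //.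
have xl := ladder_space_ell2 Xx.
have -> : u - x = (u - u') + (u' - x) by rewrite addrA subrK.
apply: (le_lt_trans (dotDD (ell2B ul u'l) (ell2B u'l xl))).
apply: (@lt_le_trans _ _ (2 * (eps ^+ 2 / 4 + eps ^+ 2 / 4))).
  rewrite ltr_pM2l ?ltr0n// ltrD//; apply: HJ => y.
  rewrite -[(u - u') y]/(u y - u' y) u'E; case: ifPn => yJ; first by left; rewrite subrr.
  by right; rewrite subr0.
by rewrite (_ : 2 * _ = eps ^+ 2)//; field.
Qed.

Lemma ladder_space_subspace : sub_inner_product_space X.
Proof.
split; first exact: ladder_space_ell2.
split; first by apply: mem_set; exact: span0.
move=> c u v /set_mem Xu /set_mem Xv; apply: mem_set.
by apply: spanD => //; apply: spanZ.
Qed.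

(** * Almost disjointness and pathology *)

Hypothesis kappa_wo : well_order (<=%O : rel kappa).
Hypothesis kappa_regular : regular_cardinal [set: kappa].
Hypothesis omega1_lt_kappa : exists a : kappa, is_omega1 a.
Hypothesis S_stationary : stationary S.
Hypothesis g_free : forall b, exists N : kappa -> nat, forall a a' j k,
  S a -> S a' -> (a < b)%O -> (a' < b)%O ->
  (N a <= j)%N -> (N a' <= k)%N -> g a j = g a' k -> a = a'.

(** Below a common bound of both points the two tails are disjoint; the finitely many rungs of [a']
    before its cut-off are avoided by going further up the ladder of [a]. *)
Lemma almost_disjoint a a' : S a -> S a' -> a' <> a ->
  exists n, forall k, (n <= k)%N -> ladder_vec a' 0 (g a k) = 0.
Proof.
move=> Sa Sa' ne.
have [b hb] : exists b, [set a; a'] `<=` below b.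
  apply: (countable_bounded kappa_regular omega1_lt_kappa).
  by apply: finite_set_countable; apply: finite_set2.
have [N HN] := g_free b.
have [n Hn] := eventually_notin [fset g a' k | k in iota 0 (N a')]%fset Sa.
exists (maxn n (N a)) => k; rewrite geq_max => /andP[nk Nk].
apply: contrapT => /ladder_vec_neq0[ga|[j [_ gj]]]; first by apply: (@gS a k); rewrite ga.
have [lj|lj] := leqP (N a') j.
  apply: ne; apply/esym; apply: (HN a a' k j) => //; apply: hb; by [left|right].
have := Hn k nk; rewrite gj => /negP; apply; apply/imfsetP; exists j => //=.
by rewrite mem_iota.
Qed.

Lemma no_vector_above a b : S a -> X b -> b a <> 0 ->
  exists x, (x < a)%O /\ b x <> 0.
Proof.
move=> Sa Xb ba; apply: contrapT => nx.
have b0 x : (x < a)%O -> b x = 0.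
  by move=> xa; apply: contrapT => bx; apply: nx; exists x.
have [J [J0 [JS bJ rJ]]] := ladder_space_decomp Xb.
have [n1 Hn1] := eventually_notin J0 Sa.
have [n2 Hn2] : exists n, forall k, (n <= k)%N ->
    forall a', a' \in (J : seq kappa) -> a' <> a -> ladder_vec a' 0 (g a k) = 0.
  have : forall a', a' \in (J : seq kappa) -> S a' by exact: JS.
  elim: (J : seq kappa) => [|c s IH] sS; first by exists 0%N.
  have [|m Hm] := IH; first by move=> c' hc'; apply: sS; rewrite in_cons hc' orbT.
  have [ca|/eqP ca] := eqVneq c a.
    exists m => k mk a'; rewrite in_cons => /orP[/eqP ->//|]; exact: Hm.
  have [m' Hm'] := almost_disjoint Sa (sS c (mem_head _ _)) ca.
  exists (maxn m m') => k; rewrite geq_max => /andP[mk mk'] a'.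
  rewrite in_cons => /orP[/eqP -> _|]; [exact: Hm'|exact: Hm].
pose k := maxn n1 n2.
(* At this rung the remainder, the vector b and all other ladder vectors in the decomposition
   vanish, leaving b(a) * coef k = 0. *)
have := rJ _ (Hn1 k (leq_maxl _ _)); rewrite remainderE b0 ?g_lt// sub0r.
rewrite (bigD1_seq a) ?fset_uniq ?bJ//= big_seq_cond big1 ?addr0; last first.
  by move=> c /andP[cJ /eqP ca]; rewrite (Hn2 k (leq_maxr _ _) c cJ ca) mulr0.
rewrite ladder_vec_g//= => /eqP; rewrite oppr_eq0 mulf_eq0 => /orP[/eqP//|].
by rewrite (negbTE (coef_neq0 k)).
Qed.

Lemma ladder_space_pathological : pathological dot X.
Proof.
move=> [B [BX Borth Bdense]].
have Bl : B `<=` ell2 by move=> b /BX; exact: ladder_space_ell2.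
have Bcount x : countable [set b | B b /\ b x <> 0].
  (* Extended by 0 outside [B], so that the summability lemmas apply over all vectors. *)
  pose f (b : V) : K := if `[< B b >] then `|b x| ^+ 2 else 0.
  have f0 b : 0 <= f b by rewrite /f; case: ifP => // _; rewrite exprn_ge0.
  have : bounded_sums f.
    exists 1 => J; pose J' := [fset b in J | `[< B b >]]%fset.
    rewrite (eq_bigr f); last by move=> b _; rewrite ger0_norm.
    rewrite -(@fset_sum_subset _ _ f J' J); last 2 first.
    - by apply/fsubsetP => b; rewrite !inE => /andP[].
    - by move=> b bJ; rewrite !inE bJ /= /f => /negbTE ->.
    apply: le_trans (@bessel R F kappa B x J' Bl Borth _); last first.
      by move=> b; rewrite !inE => /andP[_ /asboolP].
    rewrite [leLHS]big_seq [leRHS]big_seq; apply: ler_sum => b.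
    by rewrite /f !inE => /andP[_ ->].
  move=> /(bounded_sums_countable f0); apply: sub_countable.
  apply: subset_card_le => b [Bb bx] /=; rewrite /f asboolT//.
  by rewrite sqrf_eq0 normr_eq0; apply/eqP.
(* Countably many members of [B] are nonzero at x, each with countable support, so one ordinal
   bounds all these supports. *)
have /choice[h Hh] x : exists c, forall b y, B b -> b x <> 0 -> b y <> 0 -> (y < c)%O.
  have [c hc] : exists c,
      \bigcup_(b in [set b | B b /\ b x <> 0]) [set y | b y != 0] `<=` below c.
    apply: (countable_bounded kappa_regular omega1_lt_kappa).
    by apply: bigcup_countable => // b [Bb _]; apply: countable_support; apply: Bl.
  by exists c => b y Bb bx /eqP yb; apply: hc; exists b.
have [a [Sa Ca]] := S_stationary (closure_points_club kappa_wo kappa_regular omega1_lt_kappa h).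
have [b [Bb ba]] : exists b, B b /\ b a <> 0.
  apply: contrapT => nb; case: Bdense => sp dense.
  have Xa : X (ladder_vec a 0) by exact: ladder_vec_in_space.
  (* If all of [B] vanished at a, so would its span; but u_a takes the value 1 there, hence has
     distance at least 1 from the span. *)
  have [v spv] := dense _ Xa 1 ltr01; have Xv := sp v spv.
  have va : v a = 0.
    move: spv; apply: (@span_min _ _ B [set v : V | v a = 0]) => //=.
    - by move=> u w /= u0 w0; rewrite -[LHS]/(u a + w a) u0 w0 addr0.
    - by move=> c u /= u0; rewrite -[LHS]/(c * u a) u0 mulr0.
    - by move=> b Bb /=; apply: contrapT => ba; apply: nb; exists b.
  have ul := ell2B (ladder_space_ell2 Xa) (ladder_space_ell2 Xv).
  move=> /(le_lt_trans (dot_ge_coord a ul)).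
  rewrite -[(_ - _) a]/(ladder_vec a 0 a - v a) va subr0 ladder_vec_S// eqxx.
  by rewrite normr1 !expr1n ltxx.
have [x [xa bx]] := no_vector_above Sa (BX b Bb) ba.
by have := lt_le_trans (Hh x b a Bb bx ba) (Ca x xa); rewrite ltxx.
Qed.

Lemma restricted_nonpathological_bounded T b : T `<=` below b -> ladder_closed S g T ->
  nonpathological dot (restrict_supp X T).
Proof.
move=> Tb Tc; have [N HN] := g_free b.
apply: (restricted_nonpathological Tc (N := N)).
by move=> a a' j k Ta Ta' Sa Sa'; apply: HN => //; apply: Tb.
Qed.
End ladder_space.

Theorem theorem6p1 (R : realType) (F : scalar_field)
    (d : Order.disp_t) (kappa : orderType d)
    (kappa_wo : well_order (<=%O : rel kappa))
    (kappa_regular : regular_cardinal [set: kappa])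
    (omega1_lt_kappa : exists a : kappa, is_omega1 a)
    (ads : ADS_minus kappa) :
  exists X : set (kappa -> (base_field R F)^o),
    [/\ sub_inner_product_space X,
        norm_dense_in (@ell2_dot R F kappa) (@ell2 R F kappa) X,
        pathological (@ell2_dot R F kappa) X,
        forall beta : kappa,
          nonpathological (@ell2_dot R F kappa) (restrict_supp X (below beta))
      & forall lambda : kappa, regular_cardinal (below lambda) ->
          exists2 C : set (set kappa),
            club_of_subsets lambda C
            & C `<=` [set S | subsets_of_size lambda S /\
                nonpathological (@ell2_dot R F kappa) (restrict_supp X S)]].
Proof.
have [S [g [S_stat g_inj g_lt gS g_free]]] :=
  almost_disjoint_ladders kappa_wo kappa_regular omega1_lt_kappa ads.
exists (@ladder_space R F d kappa S g); split.
- exact: ladder_space_subspace.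
- exact: ladder_space_dense.
- exact: ladder_space_pathological.
- move=> beta.
  apply: (restricted_nonpathological_bounded R F g_inj gS g_free (@subset_refl _ (below beta))).
  by move=> a n Sa ab; apply: lt_trans ab; apply: g_lt.
- move=> lambda lreg.
  exists [set T | subsets_of_size lambda T /\ ladder_closed S g T].
    exact: ladder_closed_club.
  move=> T [sT Tc]; split=> //.
  have [b Tb] := small_size_bounded kappa_regular sT.
  exact: (restricted_nonpathological_bounded R F g_inj gS g_free Tb Tc).
Qed.
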